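(* For each integer $m>1$, the smooth manifolds underlying the real Lie groups $SL(2m-1,\mathbb{R})$ and $SU(m,m-1)$ have complex product structures which are invariant by left translations.
   Context: Let $M$ be a smooth manifold with tangent bundle $TM$. An almost product structure on $M$ is a smooth fibrewise linear involution $P:TM\to TM$ ($P^2=\mathrm{Id}$) of constant trace; it is a product structure if it is integrable, i.e. $N_P(X,Y)=[P(X),P(Y)]+[X,Y]-P([P(X),Y])-P([X,P(Y)])=0$ for all vector fields $X,Y$ on $M$. A complex structure is a smooth fibrewise linear $J:TM\to TM$ with $J^2=-\mathrm{Id}$ which is integrable, i.e. $N_J(X,Y)=[J(X),J(Y)]-[X,Y]-J([J(X),Y])-J([X,J(Y)])=0$ for all vector fields $X,Y$. A complex product structure on $M$ is a couple $(P,J)$ where $P$ is a product structure, $J$ is a complex structure, and $PJ=-JP$. A complex product structure on a Lie group $G$ is (left) invariant if all left translations of $G$ preserve both $P$ and $J$. $SU(m,m-1)$ is the group of complex $(2m-1)\times(2m-1)$ matrices of determinant $1$ preserving a Hermitian form of signature $(m,m-1)$. *)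

(* Defs.v *)
From HB Require Import structures.
From mathcomp Require Import all_boot all_order all_algebra.
From mathcomp Require Import complex.
From mathcomp Require Import all_classical all_reals all_analysis.

Set Implicit Arguments.
Unset Strict Implicit.
Unset Printing Implicit Defensive.

Import Order.TTheory GRing.Theory Num.Theory.
Import numFieldNormedType.Exports.

Local Open Scope classical_set_scope.
Local Open Scope ring_scope.
Local Open Scope sesquilinear_scope.

(* A manifold is given as an embedded submanifold [M : set V] of a
   finite-dimensional real vector space [V]; these definitions have their usual
   meaning only for such [M].  Tensors on [M] are total functions on [V] whose
   values off [M] (resp. off the tangent spaces of [M]) are irrelevant. *)

Section Smoothness.
Context {R : realType}.

(* Class C^k on an open set [U]. *)
Fixpoint Ck {V W : normedModType R} (k : nat) (U : set V) (f : V -> W) : Prop :=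
  match k with
  | 0%N => forall x, U x -> {for x, continuous f}
  | k'.+1 => (forall x, U x -> differentiable f x) /\
             (forall v : V, Ck k' U (fun x => 'D_v f x))
  end.

Definition smooth_open {V W : normedModType R} (U : set V) (f : V -> W) : Prop :=
  open U /\ forall k, Ck k U f.

(* Smoothness of a map defined on an arbitrary subset: near each point of [S]
   it extends to a smooth map on an open subset of the ambient space. *)
Definition smooth_on {V W : normedModType R} (S : set V) (f : V -> W) : Prop :=
  forall p, S p -> exists (U : set V) (g : V -> W),
    [/\ U p, smooth_open U g & forall x, U x -> S x -> f x = g x].

End Smoothness.

Section TangentBundle.
Context {R : realType} {V : normedModType R}.

Definition curve_at (M : set V) (p v : V) (c : R -> V) : Prop :=
  [/\ c 0 = p, derive1 c 0 = v &
      exists U : set R,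
        [/\ U 0, smooth_open (V := R) U c & forall t, U t -> M (c t)]].

Definition tangent (M : set V) (p : V) : set V :=
  [set v | exists c, curve_at M p v c].

Definition tangent_bundle (M : set V) : set (V * V) :=
  [set q | M q.1 /\ tangent M q.1 q.2].

(* The differential at [p], applied to [v], of a map [f] defined on [M]: it is
   [(f \o c)'(0)] for any curve [c] in [M] with [c(0) = p] and [c'(0) = v]. *)
Definition tdiff {W : normedModType R} (M : set V) (f : V -> W) (p v : V) : W :=
  derive1 (f \o xget (cst p) [set c | curve_at M p v c]) 0.

Definition vector_field (M : set V) (X : V -> V) : Prop :=
  (forall p, M p -> tangent M p (X p)) /\ smooth_on M X.

(* [X, Y] for the convention [X, Y] f = X (Y f) - Y (X f), computed on the
   linear coordinates of [V]. *)
Definition lie_bracket (M : set V) (X Y : V -> V) (p : V) : V :=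
  tdiff M Y p (X p) - tdiff M X p (Y p).

End TangentBundle.

Section ComplexProductStructures.
Context {R : realType} {V : normedModType R}.
Implicit Types (M : set V) (P J : V -> V -> V).

Definition smooth_tangent_endo M P : Prop :=
  [/\ forall p v, M p -> tangent M p v -> tangent M p (P p v),
      forall p (a : R) u v, M p -> tangent M p u -> tangent M p v ->
        P p (a *: u + v) = a *: P p u + P p v
    & smooth_on (tangent_bundle M) (fun q : V * V => P q.1 q.2)].

Definition tangent_basis M p d (b : 'I_d -> V) : Prop :=
  forall v, tangent M p v <->
    exists! x : 'rV[R]_d, v = \sum_(i < d) x ord0 i *: b i.

Definition has_trace M P p (t : R) : Prop :=
  exists (d : nat) (b : 'I_d -> V) (A : 'M[R]_d),
    [/\ tangent_basis M p b,
        forall j, P p (b j) = \sum_(i < d) A i j *: b i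
      & \tr A = t].

Definition almost_product_structure M P : Prop :=
  [/\ smooth_tangent_endo M P,
      forall p v, M p -> tangent M p v -> P p (P p v) = v
    & exists t : R, forall p, M p -> has_trace M P p t].

Definition app P (X : V -> V) : V -> V := fun p => P p (X p).

Definition product_structure M P : Prop :=
  almost_product_structure M P /\
  forall X Y, vector_field M X -> vector_field M Y -> forall p, M p ->
    lie_bracket M (app P X) (app P Y) p + lie_bracket M X Y p
      - P p (lie_bracket M (app P X) Y p)
      - P p (lie_bracket M X (app P Y) p) = 0.

Definition complex_structure M J : Prop :=
  [/\ smooth_tangent_endo M J,
      forall p v, M p -> tangent M p v -> J p (J p v) = - v
    & forall X Y, vector_field M X -> vector_field M Y -> forall p, M p ->
        lie_bracket M (app J X) (app J Y) p - lie_bracket M X Y p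
          - J p (lie_bracket M (app J X) Y p)
          - J p (lie_bracket M X (app J Y) p) = 0].

Definition complex_product_structure M P J : Prop :=
  [/\ product_structure M P, complex_structure M J
    & forall p v, M p -> tangent M p v -> P p (J p v) = - J p (P p v)].

(* All left translations of the group [G] with multiplication [mul] preserve
   [P], i.e. their differentials commute with [P]. *)
Definition left_invariant (G : set V) (mul : V -> V -> V) P : Prop :=
  forall g h v, G g -> G h -> tangent G h v ->
    P (mul g h) (tdiff G (mul g) h v) = tdiff G (mul g) h (P h v).

End ComplexProductStructures.

Section Groups.
Variable R : realType.

Definition SL (n : nat) : set 'M[R]_n := [set A | \det A = 1].

(* Complex n x n matrices, as a real normed space, are represented by the pair
   of their real and imaginary parts. *)
Definition cmx n (A : 'M[R]_n * 'M[R]_n) : 'M[R[i]]_n :=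
  \matrix_(i, j) Complex (A.1 i j) (A.2 i j).

Definition of_cmx n (Z : 'M[R[i]]_n) : 'M[R]_n * 'M[R]_n :=
  (map_mx (@complex.Re R) Z, map_mx (@complex.Im R) Z).

Definition mul_cmx n (A B : 'M[R]_n * 'M[R]_n) : 'M[R]_n * 'M[R]_n :=
  of_cmx (cmx A *m cmx B).

Definition hermitian_signature (p q : nat) (H : 'M[R[i]]_(p + q)) : Prop :=
  H \is hermsymmx /\
  exists2 Q : 'M[R[i]]_(p + q), Q \in unitmx &
    Q ^t* *m H *m Q = block_mx 1%:M 0 0 (- 1%:M).

(* The group of complex matrices of determinant 1 preserving the form of Gram
   matrix [H]; it is SU(p, q) when [H] has signature (p, q). *)
Definition SU n (H : 'M[R[i]]_n) : set ('M[R]_n * 'M[R]_n) :=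
  [set A | \det (cmx A) = 1 /\ (cmx A) ^t* *m H *m cmx A = H].

End Groups.

Arguments SL : clear implicits.
Arguments hermitian_signature {R} p q H.
Arguments mul_cmx {R n}.

(* Main.v *)
(* A left-invariant endomorphism of a matrix group G is a linear endomorphism
   of its Lie algebra g, and on left-invariant data the Nijenhuis tensor is the
   algebraic one.  So it suffices to find, on g, anticommuting P and J with
   P^2 = 1, J^2 = -1 and vanishing algebraic Nijenhuis tensors.

   Write F^n = (F^2 (x) F^k) (+) F with n = 2k+1, and order the k planes and the
   last line into levels.  A traceless 2 x 2 matrix z acts on gl_n by left
   multiplication on the blocks above the diagonal, by minus right
   multiplication on the blocks below it, and on a diagonal block
   A0 + t (A0 traceless) by left multiplication by z transported along
   A0 + t |-> A0 - w t; the last diagonal entry is then chosen so as to make the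
   trace vanish.  This operator is linear in z, squares to z^2 on sl_n, and its
   Nijenhuis tensor vanishes, because for every eigenline of z the eigenspace of
   the operator is a subalgebra of a Borel subalgebra.  Hence anticommuting z's
   with squares 1 and -1 give P and J.  For w = -1 everything is real, which
   settles sl(n, R); for w = i the operator commutes with X |-> D X^* D when z
   lies in su(1,1), so it preserves su(k+1, k). *)

Require Import Defs.
From HB Require Import structures.
From mathcomp Require Import all_boot all_order all_algebra.
From mathcomp Require Import fingroup perm.
From mathcomp Require Import complex.
From mathcomp Require Import all_classical all_reals all_analysis.
From mathcomp Require Import zify ring.
Set Implicit Arguments. Unset Strict Implicit. Unset Printing Implicit Defensive.
Import Order.TTheory GRing.Theory Num.Theory.
Import numFieldNormedType.Exports.
Local Open Scope classical_set_scope.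
Local Open Scope ring_scope.

(** Since z^2 is a scalar on the planes but 0 on the middle vector, the line has to be the last
    level: the rows of a strictly upper block and the columns of a strictly lower block then never
    meet the middle vector. Integrability is not derived from eigenspaces, which need not be defined
    over the base field, but checked on pairs of graded pieces. The delicate pair is upper against
    lower, whose bracket spreads over all pieces; there the sum [S X, Y] + [X, S Y] collapses to
    [z, X Y].

    Taking adjoints turns left multiplication by z into minus right multiplication. On a diagonal
    block these differ by the anticommutator with z, which by Cayley-Hamilton depends on two scalars
    of the block only; w rescales these scalars, and this is where |w| = 1 and w + 1/w = 0 come
    from.

    A tangent space is a set of velocities of curves, so identifying the Lie algebra requires
    explicit curves in the group. The group inverse is replaced by a map smooth on the whole ambient
    space which agrees with it on the group. *)

Section MatrixEntries.
Context {F : pzRingType} {m n : nat}.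
Implicit Types A B : 'M[F]_(m, n).

Lemma addmxE A B i j : (A + B) i j = A i j + B i j. Proof. by rewrite mxE. Qed.
Lemma oppmxE A i j : (- A) i j = - A i j. Proof. by rewrite mxE. Qed.
Lemma scalemxE a A i j : (a *: A) i j = a * A i j. Proof. by rewrite mxE. Qed.
Lemma zeromxE i j : (0 : 'M[F]_(m, n)) i j = 0. Proof. by rewrite mxE. Qed.

End MatrixEntries.

(* Noncommutative identities become linear ones in the entries of the
   monomials once all products are expanded. *)
Ltac mxring :=
  rewrite ?(mulmxDl, mulmxDr, mulmxBl, mulmxBr, mulmxN, mulNmx, mulmxA, scalerDr,
            scalerBr, mul0mx, mulmx0);
  rewrite -?scalemxAl -?scalemxAr -?scalemxAl -?scalemxAr ?mulmxA;
  apply/matrixP => ? ?;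
  rewrite ?(addmxE, oppmxE, scalemxE, zeromxE); ring.

(** * Block matrices graded by level *)

Section PencilEndomorphism.
Context {F : fieldType} {n : nat} (k : nat) (hn : n = k.*2.+1).
Implicit Types (X Y : 'M[F]_n) (a b c : 'I_n).

(* The plane of level [a < k] is spanned by the basis vectors [a] and
   [rev_ord a]; the line of the middle vector has level [k]. *)
Definition lev a : nat := minn a (rev_ord a).

Lemma lev_eq a b : (lev a == lev b) = (a == b) || (a == rev_ord b).
Proof.
have := ltn_ord a; have := ltn_ord b; rewrite -!val_eqE /= /lev /=; lia.
Qed.

Lemma rev_ord_eq a : (rev_ord a == a) = (a == k :> nat).
Proof. have := ltn_ord a; rewrite -!val_eqE /=; lia. Qed.

Lemma rev_ord_mid a : (rev_ord a == k :> nat) = (a == k :> nat).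
Proof. have := ltn_ord a; rewrite /=; lia. Qed.

Lemma lev_rev a : lev (rev_ord a) = lev a.
Proof. by rewrite /lev rev_ordK minnC. Qed.

Lemma lev_max a : (lev a <= k)%N.
Proof. have := ltn_ord a; rewrite /lev /=; lia. Qed.

Lemma lev_mid a : (lev a == k) = (a == k :> nat).
Proof. have := ltn_ord a; rewrite /lev /=; lia. Qed.

Definition graded (r : rel nat) X := forall a b, ~~ r (lev a) (lev b) -> X a b = 0.

Lemma gradedM (r s t : rel nat) X Y :
  (forall x y z, r x y -> s y z -> t x z) ->
  graded r X -> graded s Y -> graded t (X *m Y).
Proof.
move=> rst gX gY a b nt; rewrite mxE big1 // => c _.
have [rac|/gX ->] := boolP (r (lev a) (lev c)); last by rewrite mul0r.
have [scb|/gY ->] := boolP (s (lev c) (lev b)); last by rewrite mulr0.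
by rewrite (rst _ _ _ rac scb) in nt.
Qed.

Lemma gradedD r X Y : graded r X -> graded r Y -> graded r (X + Y).
Proof. by move=> gX gY a b nr; rewrite mxE gX // gY // addr0. Qed.
Lemma gradedN r X : graded r X -> graded r (- X).
Proof. by move=> gX a b nr; rewrite mxE gX // oppr0. Qed.
Lemma gradedB r X Y : graded r X -> graded r Y -> graded r (X - Y).
Proof. by move=> gX gY; apply/gradedD/gradedN. Qed.
Lemma gradedZ r x X : graded r X -> graded r (x *: X).
Proof. by move=> gX a b nr; rewrite mxE gX // mulr0. Qed.

Notation isU := (graded (fun x y => x < y)%N).
Notation isL := (graded (fun x y => y < x)%N).
Notation isD := (graded (fun x y => x == y)).

Lemma gradedUU X Y : isU X -> isU Y -> isU (X *m Y).
Proof. by clear hn; apply: gradedM => x y z /=; lia. Qed.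
Lemma gradedLL X Y : isL X -> isL Y -> isL (X *m Y).
Proof. by clear hn; apply: gradedM => x y z /=; lia. Qed.
Lemma gradedDD X Y : isD X -> isD Y -> isD (X *m Y).
Proof. by clear hn; apply: gradedM => x y z /=; lia. Qed.
Lemma gradedDU X Y : isD X -> isU Y -> isU (X *m Y).
Proof. by clear hn; apply: gradedM => x y z /=; lia. Qed.
Lemma gradedUD X Y : isU X -> isD Y -> isU (X *m Y).
Proof. by clear hn; apply: gradedM => x y z /=; lia. Qed.
Lemma gradedDL X Y : isD X -> isL Y -> isL (X *m Y).
Proof. by clear hn; apply: gradedM => x y z /=; lia. Qed.
Lemma gradedLD X Y : isL X -> isD Y -> isL (X *m Y).
Proof. by clear hn; apply: gradedM => x y z /=; lia. Qed.

Definition part (r : rel nat) X : 'M[F]_n :=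
  \matrix_(a, b) (if r (lev a) (lev b) then X a b else 0).

Lemma part_graded r X : graded r (part r X).
Proof. by move=> a b /negbTE nr; rewrite mxE nr. Qed.

Definition upp := part (fun x y => x <= y)%N.
Definition low := part (fun x y => y < x)%N.

Lemma uppE X : upp X = X - low X.
Proof. by apply/matrixP=> a b; rewrite !mxE; case: ltnP; rewrite ?subr0 ?subrr. Qed.

Lemma lowD X Y : low (X + Y) = low X + low Y.
Proof. by apply/matrixP=> a b; rewrite !mxE; case: ifP; rewrite ?addr0. Qed.
Lemma lowZ x X : low (x *: X) = x *: low X.
Proof. by apply/matrixP=> a b; rewrite !mxE; case: ifP; rewrite ?mulr0. Qed.
Lemma low0 : low 0 = 0.
Proof. by apply/matrixP=> a b; rewrite !mxE if_same. Qed.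
Lemma lowN X : low (- X) = - low X.
Proof. by rewrite -scaleN1r lowZ scaleN1r. Qed.
Lemma lowB X Y : low (X - Y) = low X - low Y.
Proof. by rewrite lowD lowN. Qed.
Lemma low_id X : isL X -> low X = X.
Proof. by move=> LX; apply/matrixP=> a b; rewrite !mxE; case: ifPn => // /LX. Qed.
Lemma low_U X : isU X -> low X = 0.
Proof.
move=> UX; apply/matrixP=> a b; rewrite !mxE; case: ifP => // ab; apply: UX.
by rewrite -leqNgt ltnW.
Qed.
Lemma low_D X : isD X -> low X = 0.
Proof.
by move=> DX; apply/matrixP=> a b; rewrite !mxE; case: ifP => // ab; apply: DX; clear hn; lia.
Qed.

Lemma lowDl X Y : isD X -> low (X *m Y) = X *m low Y.
Proof.
move=> DX; apply/matrixP=> a b; rewrite !mxE.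
case: ifP => ab; last first.
  rewrite big1 // => c _; rewrite mxE.
  by have [<-|/DX ->] := eqVneq (lev a) (lev c); rewrite ?ab ?mulr0 ?mul0r.
apply: eq_bigr => c _; rewrite mxE.
by have [<-|/DX ->] := eqVneq (lev a) (lev c); rewrite ?ab ?mulr0 ?mul0r.
Qed.

Lemma lowDr X Y : isD Y -> low (X *m Y) = low X *m Y.
Proof.
move=> DX; apply/matrixP=> a b; rewrite !mxE.
case: ifP => ab; last first.
  rewrite big1 // => c _; rewrite mxE.
  by have [->|/DX ->] := eqVneq (lev c) (lev b); rewrite ?ab ?mulr0 ?mul0r.
apply: eq_bigr => c _; rewrite mxE.
by have [->|/DX ->] := eqVneq (lev c) (lev b); rewrite ?ab ?mulr0 ?mul0r.
Qed.

Definition dgm (f : 'I_n -> F) : 'M[F]_n := diag_mx (\row_a f a).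

Lemma dgmE f a b : dgm f a b = f a *+ (a == b).
Proof. by rewrite !mxE. Qed.
Lemma dgmMl f X a b : (dgm f *m X) a b = f a * X a b.
Proof. by rewrite mul_diag_mx !mxE. Qed.
Lemma dgmMr f X a b : (X *m dgm f) a b = X a b * f b.
Proof. by rewrite mul_mx_diag !mxE. Qed.
Lemma dgm_D f : isD (dgm f).
Proof. by move=> a b; rewrite dgmE; have [->|//] := eqVneq a b; rewrite eqxx. Qed.
(** Such an [f] is constant on each level, so [dgm f] is scalar on every diagonal block. *)
Lemma dgm_comm f X : (forall a, f (rev_ord a) = f a) -> isD X -> dgm f *m X = X *m dgm f.
Proof.
move=> fr DX; apply/matrixP=> a b; rewrite dgmMl dgmMr mulrC.
have [|/DX ->] := eqVneq (lev a) (lev b); last by rewrite !mul0r.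
by move/eqP; rewrite lev_eq => /orP[/eqP->//|/eqP->]; rewrite fr.
Qed.

Definition mid : 'M[F]_n := dgm (fun a => (a == k :> nat)%:R).

Lemma mid_comm X : isD X -> mid *m X = X *m mid.
Proof. by apply: dgm_comm => a; rewrite rev_ord_mid. Qed.

Lemma mid_lt : (k < n)%N. Proof. lia. Qed.
Definition mid_ord : 'I_n := Ordinal mid_lt.

Lemma rev_mid : rev_ord mid_ord = mid_ord.
Proof. by apply/eqP; rewrite rev_ord_eq. Qed.

Lemma mid_ordP a : (a == k :> nat) = (a == mid_ord).
Proof. by rewrite -val_eqE. Qed.

Lemma mulmid X : isD X -> mid *m X = X mid_ord mid_ord *: mid.
Proof.
move=> DX; apply/matrixP => a b; rewrite dgmMl scalemxE dgmE mid_ordP.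
case: (a =P mid_ord) => [->|]; last by rewrite mul0r mul0rn mulr0.
rewrite mul1r; have [<-|nb] := eqVneq mid_ord b; first by rewrite mulr1.
rewrite mulr0 DX // lev_eq (negbTE nb) /=.
by rewrite -(inj_eq rev_ord_inj) rev_ordK rev_mid.
Qed.

(** The middle vector has the highest level, so a strictly upper matrix has no entry in its row.
    This and [L_mid] make [gen *m gen] act as a scalar on the side where it is applied. *)
Lemma mid_U X : isU X -> mid *m X = 0.
Proof.
move=> UX; apply/matrixP => a b; rewrite dgmMl zeromxE.
case: eqP => [ak|]; last by rewrite mul0r.
rewrite UX ?mulr0 // -leqNgt; move/eqP: ak; rewrite -lev_mid => /eqP ->.
exact: lev_max.
Qed.

Lemma L_mid X : isL X -> X *m mid = 0.
Proof.
move=> LX; apply/matrixP => a b; rewrite dgmMr zeromxE.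
case: eqP => [bk|]; last by rewrite mulr0.
rewrite LX ?mul0r // -leqNgt; move/eqP: bk; rewrite -lev_mid => /eqP ->.
exact: lev_max.
Qed.

Lemma mul_mid_mid : mid *m mid = mid.
Proof.
rewrite mulmid; last exact: dgm_D.
by rewrite dgmE !eqxx scale1r.
Qed.

(** * Partial traces over the planes *)

Context (two0 : (2 : F) != 0).

(* [ptr X] replaces each 2 x 2 diagonal block of [X] by half its trace. *)
Definition ptr X : 'M[F]_n :=
  dgm (fun a => if a == k :> nat then 0 else (X a a + X (rev_ord a) (rev_ord a)) / 2).

Lemma ptrE X a b : ptr X a b =
  (if a == k :> nat then 0 else (X a a + X (rev_ord a) (rev_ord a)) / 2) *+ (a == b).
Proof. exact: dgmE. Qed.

Lemma ptr_comm X Y : isD Y -> ptr X *m Y = Y *m ptr X.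
Proof.
move=> DY; apply: dgm_comm => // a; rewrite rev_ord_mid rev_ordK.
by case: ifP => // _; rewrite addrC.
Qed.

Lemma ptr_D X : isD (ptr X). Proof. exact: dgm_D. Qed.

Lemma ptrP (x : F) X Y : ptr (X + x *: Y) = ptr X + x *: ptr Y.
Proof.
apply/matrixP => a b; rewrite addmxE scalemxE !ptrE !mxE.
by case: ifP => _; case: (a == b); rewrite ?mulr0n ?mulr1n; try ring; field.
Qed.
Lemma ptrD X Y : ptr (X + Y) = ptr X + ptr Y.
Proof. by rewrite -[Y]scale1r ptrP !scale1r. Qed.
Lemma ptr0 : ptr 0 = 0.
Proof. by have := ptrP (-1) 0 0; rewrite scaler0 addr0 scaleN1r subrr. Qed.
Lemma ptrZ x X : ptr (x *: X) = x *: ptr X.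
Proof. by rewrite -[x *: X]add0r ptrP ptr0 add0r. Qed.
Lemma ptrN X : ptr (- X) = - ptr X.
Proof. by rewrite -scaleN1r ptrZ scaleN1r. Qed.
Lemma ptrB X Y : ptr (X - Y) = ptr X - ptr Y.
Proof. by rewrite ptrD ptrN. Qed.

Lemma ptr_diag0 X : (forall a, X a a = 0) -> ptr X = 0.
Proof.
move=> X0; apply/matrixP => a b; rewrite ptrE !X0 addr0 mul0r if_same mul0rn.
by rewrite zeromxE.
Qed.

Lemma ptr_U X : isU X -> ptr X = 0.
Proof. by move=> UX; apply: ptr_diag0 => a; rewrite UX ?ltnn. Qed.
Lemma ptr_L X : isL X -> ptr X = 0.
Proof. by move=> UX; apply: ptr_diag0 => a; rewrite UX ?ltnn. Qed.

Lemma big_pair (f : 'I_n -> F) a : a != k :> nat ->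
  (forall c, lev c != lev a -> f c = 0) -> \sum_c f c = f a + f (rev_ord a).
Proof.
move=> ak f0; have ra : rev_ord a != a by rewrite rev_ord_eq.
rewrite (bigD1 a) //= (bigD1 (rev_ord a)) //= big1 ?addr0 // => c /andP[ca cr].
by apply: f0; rewrite lev_eq negb_or ca.
Qed.

Lemma mulD_E X Y a b : isD X -> a != k :> nat ->
  (X *m Y) a b = X a a * Y a b + X a (rev_ord a) * Y (rev_ord a) b.
Proof.
move=> DX ak; rewrite mxE (big_pair ak) // => c ca.
by rewrite DX ?mul0r // eq_sym.
Qed.

Lemma mulmD_E X Y a b : isD Y -> b != k :> nat ->
  (X *m Y) a b = X a b * Y b b + X a (rev_ord b) * Y (rev_ord b) b.
Proof.
by move=> DX bk; rewrite mxE (big_pair bk) // => c ca; rewrite DX ?mulr0.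
Qed.

(** With [X] block diagonal, the diagonal blocks of both products involve only the diagonal blocks
    of [Y], so this is cyclicity of the trace plane by plane. *)
Lemma ptr_cyc X Y : isD X -> ptr (X *m Y) = ptr (Y *m X).
Proof.
move=> DX; apply/matrixP => a b; rewrite !ptrE; congr (_ *+ _); case: ifPn => // ak.
have rk : rev_ord a != k :> nat by rewrite rev_ord_mid.
rewrite !(mulD_E _ _ DX) // !(mulmD_E _ _ DX) // !rev_ordK; ring.
Qed.

Lemma tr_ptr X : \tr (ptr X) = \tr X - X mid_ord mid_ord.
Proof.
rewrite /mxtrace; under eq_bigr do rewrite ptrE eqxx mulr1n.
rewrite [in RHS](bigD1 mid_ord) //= addrAC subrr add0r.
rewrite (bigID (fun a => a == mid_ord)) /= big_pred1_eq /= eqxx add0r.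
under eq_bigr => a am do rewrite mid_ordP (negbTE am).
rewrite -mulr_suml big_split /=.
have <- : \sum_(a | a != mid_ord) X a a = \sum_(a | a != mid_ord) X (rev_ord a) (rev_ord a).
  rewrite (reindex_inj rev_ord_inj); apply: eq_bigl => a /=.
  by rewrite -!mid_ordP rev_ord_mid.
by field.
Qed.

Lemma tr_offdiag X : (forall a, X a a = 0) -> \tr X = 0.
Proof. by move=> X0; rewrite /mxtrace big1. Qed.

(** * The operator attached to a traceless 2 x 2 matrix z, its square and its Nijenhuis tensor *)

Section Generator.
Variables al be ga : F.

(* The traceless 2 x 2 matrix [[al, be], [ga, -al]] acting on each
   plane. *)
Definition gen : 'M[F]_n := \matrix_(a, b)
  ((if (a < k)%N then al else if (k < a)%N then - al else 0) *+ (a == b) +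
   (if (a < k)%N then be else if (k < a)%N then ga else 0) *+ (rev_ord a == b)).

(** Minus the determinant of z; by Cayley-Hamilton, z^2 is this scalar. *)
Definition gen_sq : F := al ^+ 2 + be * ga.

Lemma gen_D : isD gen.
Proof.
move=> a b; rewrite lev_eq negb_or => /andP[ab arb].
rewrite mxE (negbTE ab) -(inj_eq rev_ord_inj) rev_ordK (negbTE arb).
by rewrite !mulr0n addr0.
Qed.

Lemma genMl X a b : (gen *m X) a b =
  (if (a < k)%N then al else if (k < a)%N then - al else 0) * X a b +
  (if (a < k)%N then be else if (k < a)%N then ga else 0) * X (rev_ord a) b.
Proof.
have [ak|ak] := eqVneq (a : nat) k.
  rewrite -ak !ltnn !mul0r addr0 mxE big1 // => c _.
  by rewrite mxE -ak ltnn !mul0rn addr0 mul0r.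
rewrite (mulD_E _ _ gen_D) // !mxE !eqxx !rev_ord_eq (negbTE ak) eq_sym rev_ord_eq.
by rewrite (negbTE ak) !mulr0n !mulr1n addr0 add0r.
Qed.

Lemma gen_gen : gen *m gen = gen_sq *: (1%:M - mid).
Proof.
apply/matrixP => a b; rewrite genMl [RHS]mxE [in RHS]mxE !mxE rev_ordK /gen_sq.
rewrite -!(inj_eq val_inj) /=.
have := ltn_ord a; have := ltn_ord b => hb ha.
have -> : (n - a.+1 < k)%N = (k < a)%N by lia.
have -> : (k < n - a.+1)%N = (a < k)%N by lia.
case: (ltngtP a k) => ak /=; rewrite ?mulr0n ?mulr1n.
- have -> : (a == b :> nat) = (a == b) by [].
  by case: (a == b); case: (_ == _); rewrite ?mulr0n ?mulr1n; ring.
- by case: (_ == _); case: (_ == _); rewrite ?mulr0n ?mulr1n; ring.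
- by case: (_ == _); case: (_ == _); rewrite ?mulr0n ?mulr1n; ring.
Qed.

Lemma gen_mid : gen *m mid = 0.
Proof.
rewrite -mid_comm; last exact: gen_D.
apply/matrixP => a b; rewrite dgmMl mxE zeromxE; case: eqP => [->|]; last by rewrite mul0r.
by rewrite ltnn !mul0rn addr0 mulr0.
Qed.

Lemma mid_gen : mid *m gen = 0.
Proof. by rewrite mid_comm ?gen_mid //; apply: gen_D. Qed.

Lemma gen_diag a : gen a a = if (a < k)%N then al else if (k < a)%N then - al else 0.
Proof.
rewrite mxE eqxx rev_ord_eq mulr1n.
by case: (ltngtP a k) => _ /=; rewrite ?mulr0n ?mulr1n ?addr0.
Qed.

Lemma gen_diag_rev a : gen (rev_ord a) (rev_ord a) = - gen a a.
Proof.
rewrite !gen_diag /=; have := ltn_ord a => ha.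
have -> : (n - a.+1 < k)%N = (k < a)%N by lia.
have -> : (k < n - a.+1)%N = (a < k)%N by lia.
by case: (ltngtP a k); rewrite ?opprK ?oppr0.
Qed.

Lemma ptr_ptr X : ptr (ptr X) = ptr X.
Proof.
apply/matrixP => a b; rewrite [LHS]ptrE [RHS]ptrE !ptrE !eqxx !rev_ord_mid rev_ordK !mulr1n.
by congr (_ *+ _); case: ifPn => // /negbTE ->; field.
Qed.

Lemma ptr_mid : ptr mid = 0.
Proof.
apply/matrixP => a b; rewrite ptrE zeromxE !dgmE !eqxx rev_ord_mid.
by case: eqP => _; rewrite ?mulr0n ?addr0 ?mul0r mul0rn.
Qed.

Lemma mul_ptr_mid X : ptr X *m mid = 0.
Proof.
apply/matrixP => a b; rewrite dgmMr ptrE zeromxE.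
have [<-|_] := eqVneq a b; last by rewrite mulr0n mul0r.
by case: eqP => _; rewrite ?mulr0 ?mulr0n ?mul0rn ?mul0r.
Qed.

Lemma ptr_ptr_gen X : ptr (ptr X *m gen) = 0.
Proof.
apply/matrixP => a b; rewrite ptrE zeromxE !dgmMl gen_diag_rev rev_ord_mid rev_ordK.
case: ifPn => [_|/negbTE ->]; rewrite ?mul0rn //.
by rewrite [X in X / 2](_ : _ = 0) ?mul0r ?mul0rn //; ring.
Qed.

Lemma ptr_gen_gen X : ptr (gen *m gen *m X) = gen_sq *: ptr X.
Proof.
rewrite gen_gen -scalemxAl mulmxBl mul1mx ptrZ ptrB ptr_cyc; last exact: dgm_D.
congr (_ *: _); rewrite -[RHS]subr0; congr (_ - _).
apply/matrixP => a b; rewrite ptrE zeromxE !dgmMr rev_ord_mid.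
by case: ifPn => [_|/negbTE ->]; rewrite ?mulr0 ?addr0 ?mul0r mul0rn.
Qed.

Lemma tr_gen X : \tr (gen *m X) = \tr (ptr (gen *m X)).
Proof. by rewrite tr_ptr genMl ltnn !mul0r addr0 subr0. Qed.

Variables (w : F) (w0 : w != 0).

(** On a diagonal block A0 + t let s = tr(z A0) / 2, so that [ptr X] is t and [ptr (gen *m X)] is s.
    Transporting left multiplication by z gives (z A0 - s) - w t z - w^-1 s, which is z (A0 + t)
    minus the first two terms here. The plane blocks then have total trace - w^-1 tr(z X), and the
    last term compensates it at the middle entry. *)
Definition corr X : 'M[F]_n :=
  (1 + w) *: (ptr X *m gen) + (1 + w^-1) *: ptr (gen *m X) - (w^-1 * \tr (gen *m X)) *: mid.

Definition pencil X : 'M[F]_n := gen *m upp X - low X *m gen - corr X.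

Lemma corr_D X : isD (corr X).
Proof.
apply: gradedB; last exact/gradedZ/dgm_D.
by apply: gradedD; apply: gradedZ; [apply: gradedDD; [exact: ptr_D|exact: gen_D]|exact: ptr_D].
Qed.

Lemma corrP (x : F) X Y : corr (X + x *: Y) = corr X + x *: corr Y.
Proof. by rewrite /corr mulmxDr -scalemxAr !ptrP !linearD /= !linearZ /=; mxring. Qed.

Lemma pencilP (x : F) X Y : pencil (X + x *: Y) = pencil X + x *: pencil Y.
Proof. by rewrite /pencil corrP !uppE lowD lowZ; mxring. Qed.
Lemma pencilD X Y : pencil (X + Y) = pencil X + pencil Y.
Proof. by rewrite -[Y]scale1r pencilP !scale1r. Qed.
Lemma pencil0 : pencil 0 = 0.
Proof. by have := pencilP (-1) 0 0; rewrite scaler0 addr0 scaleN1r subrr. Qed.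
Lemma pencilZ x X : pencil (x *: X) = x *: pencil X.
Proof. by rewrite -[x *: X]add0r pencilP pencil0 add0r. Qed.
Lemma pencilN X : pencil (- X) = - pencil X.
Proof. by rewrite -scaleN1r pencilZ scaleN1r. Qed.
(** The correction sees a matrix only through these two partial traces, since the trace of
    [gen *m X] is itself determined by its partial trace. *)
Lemma corr_eq0 X : ptr X = 0 -> ptr (gen *m X) = 0 -> corr X = 0.
Proof.
move=> p0 pg0; rewrite /corr tr_gen pg0 p0 mul0mx mxtrace0 mulr0 !scaler0 scale0r.
by rewrite addr0 subr0.
Qed.

Lemma pencil_U X : isU X -> pencil X = gen *m X.
Proof.
move=> UX; rewrite /pencil corr_eq0 ?ptr_U //.
  by rewrite uppE low_U // mul0mx !subr0.
exact/gradedDU/UX/gen_D.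
Qed.

Lemma pencil_L X : isL X -> pencil X = - (X *m gen).
Proof.
move=> LX; rewrite /pencil corr_eq0 ?ptr_L //.
  by rewrite uppE low_id // subrr mulmx0 subr0 sub0r.
exact/gradedDL/LX/gen_D.
Qed.

Lemma pencil_D X : isD X -> pencil X = gen *m X - corr X.
Proof. by move=> DX; rewrite /pencil uppE low_D // subr0 mul0mx subr0. Qed.

(* The bracket of an upper and a lower block lies in no single graded piece;
   this covers all its pieces at once. *)
Lemma pencil_comm X : mid *m X = 0 -> X *m mid = 0 ->
  pencil (gen *m X - X *m gen) = gen_sq *: X - gen *m X *m gen.
Proof.
move=> mX Xm; rewrite /pencil corr_eq0.
- rewrite uppE lowB lowDl ?lowDr; try exact: gen_D.
  have := gen_gen => gg.
  have z1 : gen *m gen *m X = gen_sq *: X by rewrite gg -scalemxAl mulmxBl mul1mx mX subr0.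
  have z2 : low X *m gen *m gen = gen_sq *: low X.
    rewrite -mulmxA gg -scalemxAr mulmxBr mulmx1 -lowDr ?Xm; last exact: dgm_D.
    by rewrite low0 subr0.
  have z3 : gen *m gen *m low X = gen_sq *: low X.
    rewrite gg -scalemxAl mulmxBl mul1mx -lowDl ?mX; last exact: dgm_D.
    by rewrite low0 subr0.
  rewrite ?(mulmxDl, mulmxDr, mulmxBl, mulmxBr, mulmxN, mulNmx, mulmxA) z1 z2 z3.
  by mxring.
- by rewrite ptrB ptr_cyc ?subrr //; apply: gen_D.
- rewrite mulmxBr ptrB mulmxA -[gen *m gen *m X]mulmxA ptr_cyc; last exact: gen_D.
  by rewrite mulmxA subrr.
Qed.

Definition comm X Y : 'M[F]_n := X *m Y - Y *m X.

(** The Nijenhuis tensor of an operator whose square is [gen_sq]; the values 1 and -1 of this scalar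
    give those of P and J. It vanishes on all of gl_n, although the operator has that square only on
    traceless matrices. *)
Definition nij X Y : 'M[F]_n :=
  comm (pencil X) (pencil Y) + gen_sq *: comm X Y
  - pencil (comm (pencil X) Y + comm X (pencil Y)).

Lemma nij_sym X Y : nij Y X = - nij X Y.
Proof.
rewrite /nij; move: (pencil X) (pencil Y) => A B.
rewrite [X in pencil X](_ : _ = - (comm A Y + comm X B)).
  by rewrite pencilN; move: (pencil _) => P; rewrite /comm; mxring.
by rewrite /comm; mxring.
Qed.

Lemma nijDr X Y1 Y2 : nij X (Y1 + Y2) = nij X Y1 + nij X Y2.
Proof.
rewrite /nij (pencilD Y1 Y2); move: (pencil X) (pencil Y1) (pencil Y2) => A B C.
rewrite [X in pencil X](_ : _ = (comm A Y1 + comm X B) + (comm A Y2 + comm X C)).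
  by rewrite pencilD; move: (pencil _) (pencil _) => P Q; rewrite /comm; mxring.
by rewrite /comm; mxring.
Qed.

Lemma nijDl X1 X2 Y : nij (X1 + X2) Y = nij X1 Y + nij X2 Y.
Proof.
have := nijDr Y X1 X2; rewrite (nij_sym X1 Y) (nij_sym X2 Y) (nij_sym (X1 + X2) Y).
by move: (nij _ _) (nij X1 _) (nij X2 _) => A B C; rewrite -opprD => /oppr_inj.
Qed.

Lemma gen_gen_U X : isU X -> gen *m gen *m X = gen_sq *: X.
Proof. by move=> UX; rewrite gen_gen -scalemxAl mulmxBl mul1mx mid_U ?subr0. Qed.

Lemma gen_gen_L X : isL X -> X *m gen *m gen = gen_sq *: X.
Proof.
by move=> LX; rewrite -mulmxA gen_gen -scalemxAr mulmxBr mulmx1 L_mid ?subr0.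
Qed.

Lemma nij_UU X Y : isU X -> isU Y -> nij X Y = 0.
Proof.
move=> UX UY; have zX := gen_gen_U UX; have zY := gen_gen_U UY.
have UgX : isU (gen *m X) by apply/gradedDU/UX/gen_D.
have UgY : isU (gen *m Y) by apply/gradedDU/UY/gen_D.
rewrite /nij (pencil_U UX) (pencil_U UY) pencil_U; last first.
  by apply: gradedD; apply: gradedB; apply: gradedUU.
rewrite /comm ?(mulmxDl, mulmxDr, mulmxBl, mulmxBr, mulmxN, mulNmx, mulmxA) zX zY.
by mxring.
Qed.

Lemma nij_LL X Y : isL X -> isL Y -> nij X Y = 0.
Proof.
move=> UX UY; have zX := gen_gen_L UX; have zY := gen_gen_L UY.
have UgX : isL (- (X *m gen)) by apply: gradedN; apply/gradedLD/gen_D.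
have UgY : isL (- (Y *m gen)) by apply: gradedN; apply/gradedLD/gen_D.
rewrite /nij (pencil_L UX) (pencil_L UY) pencil_L; last first.
  by apply: gradedD; apply: gradedB; apply: gradedLL.
rewrite /comm.
rewrite ?(mulmxDl, mulmxDr, mulmxBl, mulmxBr, mulmxN, mulNmx) -!mulmxA.
rewrite !(mulmxA X gen gen) !(mulmxA Y gen gen) zX zY.
by mxring.
Qed.

Lemma nij_UL X Y : isU X -> isL Y -> nij X Y = 0.
Proof.
move=> UX LY; have zX := gen_gen_U UX; have zY := gen_gen_L LY.
rewrite /nij (pencil_U UX) (pencil_L LY).
(* The two terms [Y *m gen *m X] cancel, leaving a commutator with [gen] that [pencil_comm]
   evaluates without splitting it into pieces. *)
have -> : comm (gen *m X) Y + comm X (- (Y *m gen)) = gen *m (X *m Y) - (X *m Y) *m gen.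
  by rewrite /comm; mxring.
rewrite pencil_comm; first last.
- by rewrite -mulmxA L_mid ?mulmx0.
- by rewrite mulmxA mid_U ?mul0mx.
rewrite /comm.
rewrite ?(mulmxDl, mulmxDr, mulmxBl, mulmxBr, mulmxN, mulNmx) -!mulmxA.
rewrite (mulmxA gen gen X) -(mulmxA gen gen X) !(mulmxA gen gen) gen_gen.
rewrite -?scalemxAl -?scalemxAr mulmxBl mul1mx mid_U // subr0.
by mxring.
Qed.

Lemma corr_gen X : corr X *m gen = gen *m corr X.
Proof.
rewrite /corr !(mulmxBl, mulmxBr, mulmxDl, mulmxDr) -!scalemxAl -!scalemxAr.
by rewrite mid_gen gen_mid -(ptr_comm (gen *m X) gen_D) mulmxA -(ptr_comm X gen_D).
Qed.

(** All corrections lie in the commutative algebra generated by [gen], [mid] and the scalars of the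
    planes. *)
Lemma corr_corr X Y : corr X *m corr Y = corr Y *m corr X.
Proof.
have comm1 : ptr X *m corr Y = corr Y *m ptr X by apply/ptr_comm/corr_D.
have comm2 : ptr (gen *m X) *m corr Y = corr Y *m ptr (gen *m X) by apply/ptr_comm/corr_D.
have comm3 : mid *m corr Y = corr Y *m mid by apply/mid_comm/corr_D.
move: (corr Y) comm1 comm2 comm3 (corr_gen Y) => C comm1 comm2 comm3 commg.
rewrite /corr !(mulmxBl, mulmxBr, mulmxDl, mulmxDr) -!scalemxAl -!scalemxAr.
by rewrite comm2 comm3 -mulmxA -commg mulmxA comm1 -mulmxA.
Qed.

(** The brackets stay strictly upper, where the operator is left multiplication by [gen]. Every term
    in [corr X] then cancels because [corr X] commutes with [gen]. *)
Lemma nij_DU X Y : isD X -> isU Y -> nij X Y = 0.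
Proof.
move=> DX UY; have zY := gen_gen_U UY.
have DpX : isD (gen *m X - corr X).
  by apply: gradedB; [apply/gradedDD/DX/gen_D|exact: corr_D].
have UgY : isU (gen *m Y) by apply/gradedDU/UY/gen_D.
have zXY : gen *m gen *m X *m Y = gen_sq *: (X *m Y).
  by rewrite -[LHS]mulmxA -[gen *m gen *m _]/(_ *m (X *m Y)) gen_gen_U //; exact: gradedDU.
move: (corr X) (corr_gen X) DpX (pencil_D DX) => cX cXg DpX pX.
rewrite /nij pX (pencil_U UY) pencil_U; last first.
  by apply: gradedD; apply: gradedB; (by apply: gradedDU) || (by apply: gradedUD).
rewrite /comm.
rewrite ?(mulmxDl, mulmxDr, mulmxBl, mulmxBr, mulmxN, mulNmx, mulmxA) zXY zY.
by rewrite cXg; mxring.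
Qed.

Lemma nij_DL X Y : isD X -> isL Y -> nij X Y = 0.
Proof.
move=> DX LY; have zY := gen_gen_L LY.
have DpX : isD (gen *m X - corr X).
  by apply: gradedB; [apply/gradedDD/DX/gen_D|exact: corr_D].
have LgY : isL (- (Y *m gen)) by apply: gradedN; apply/gradedLD/gen_D.
have YzX : Y *m gen *m corr X = Y *m corr X *m gen by rewrite -!mulmxA corr_gen.
have YXz : Y *m X *m gen *m gen = gen_sq *: (Y *m X).
  by apply: gen_gen_L; exact: gradedLD.
have XYzz : X *m Y *m gen *m gen = gen_sq *: (X *m Y).
  by apply: gen_gen_L; exact: gradedDL.
have Yzz : Y *m gen *m gen *m X = gen_sq *: (Y *m X) by rewrite zY -scalemxAl.
move: (corr X) YzX DpX (pencil_D DX) => cX YzX DpX pX.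
rewrite /nij pX (pencil_L LY) pencil_L; last first.
  by apply: gradedD; apply: gradedB; (by apply: gradedDL) || (by apply: gradedLD).
rewrite /comm.
rewrite ?(mulmxDl, mulmxDr, mulmxBl, mulmxBr, mulmxN, mulNmx, mulmxA, opprK).
rewrite Yzz YzX XYzz.
by mxring.
Qed.

(** Cyclicity of [ptr] kills both partial traces of the sum of mixed brackets, so no correction
    appears in its image. The corrections of [X] and [Y] commute with each other and with [gen], and
    what remains is the identity for plain left multiplication. *)
Lemma nij_DD X Y : isD X -> isD Y -> nij X Y = 0.
Proof.
move=> DX DY.
have DpX : isD (gen *m X - corr X).
  by apply: gradedB; [apply/gradedDD/DX/gen_D|exact: corr_D].
have DpY : isD (gen *m Y - corr Y).
  by apply: gradedB; [apply/gradedDD/DY/gen_D|exact: corr_D].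
have DcX := @corr_D X; have DcY := @corr_D Y.
have gD := gen_D.
have XX := mulmid DX; have YY := mulmid DY.
rewrite /nij; move: (corr X) (corr Y) (pencil_D DX) (pencil_D DY) DcX DcY DpX DpY
  (corr_gen X) (corr_gen Y) (corr_corr X Y) => A B -> -> DA DB DA' DB' gA gB AB.
rewrite pencil_D; last first.
  by apply: gradedD; apply: gradedB; apply: gradedDD.
rewrite corr_eq0 ?subr0.
(* The middle block is 1 x 1, so a bracket of block diagonal matrices has zero middle entry and the
   defect [mid] of [gen_gen] does not show. *)
- have mXY : gen *m gen *m (X *m Y - Y *m X) = gen_sq *: (X *m Y - Y *m X).
    rewrite gen_gen -scalemxAl mulmxBl mul1mx mulmxBr !mulmxA XX YY -!scalemxAl XX YY.
    by congr (_ *: _); mxring.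
  rewrite /comm -mXY.
  rewrite ?(mulmxDl, mulmxDr, mulmxBl, mulmxBr, mulmxN, mulNmx, mulmxA) AB gA gB -gA -gB.
  by mxring.
- by rewrite /comm !(ptrB, ptrD) (ptr_cyc Y DA') (ptr_cyc _ DX) !subrr addr0.
- rewrite /comm ?(mulmxDl, mulmxDr, mulmxBl, mulmxBr, mulmxN, mulNmx, mulmxA).
  rewrite !(ptrB, ptrD) -(mulmxA (gen *m gen) X) -(mulmxA (gen *m gen) Y) !ptr_gen_gen.
  rewrite (ptr_cyc Y DX) -gA -gB -(mulmxA A gen Y) -(mulmxA B gen X).
  rewrite (ptr_cyc (gen *m Y) DA) (ptr_cyc (gen *m X) DB).
  rewrite -(mulmxA (gen *m Y) gen X) (ptr_cyc (gen *m X)); last exact: gradedDD.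
  by rewrite !mulmxA; apply/matrixP => a b; rewrite ?(addmxE, oppmxE, zeromxE); ring.
Qed.

Lemma pencil_integrable X Y : nij X Y = 0.
Proof.
have decomp Z : Z = part (fun x y => x < y)%N Z + part (fun x y => x == y) Z + low Z.
  apply/matrixP => a b; rewrite !mxE.
  by case: ltngtP; rewrite ?addr0 ?add0r.
have gU Z : isU (part (fun x y => x < y)%N Z) by exact: part_graded.
have gDi Z : isD (part (fun x y => x == y) Z) by exact: part_graded.
have gL Z : isL (low Z) by exact: part_graded.
have nU Z : isU Z -> nij Z Y = 0.
  move=> UZ; rewrite (decomp Y) !nijDr (nij_UU UZ (gU Y)) (nij_UL UZ (gL Y)).
  by rewrite nij_sym (nij_DU (gDi Y) UZ) oppr0 !addr0.
have nL Z : isL Z -> nij Z Y = 0.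
  move=> LZ; rewrite (decomp Y) !nijDr (nij_LL LZ (gL Y)) (nij_sym (part _ Y) Z).
  rewrite (nij_sym (part _ Y) Z) (nij_UL (gU Y) LZ) (nij_DL (gDi Y) LZ).
  by rewrite oppr0 !addr0.
have nD Z : isD Z -> nij Z Y = 0.
  move=> DZ; rewrite (decomp Y) !nijDr (nij_DU DZ (gU Y)) (nij_DD DZ (gDi Y)).
  by rewrite (nij_DL DZ (gL Y)) !addr0.
by rewrite (decomp X) !nijDl (nU _ (gU X)) (nD _ (gDi X)) (nL _ (gL X)) !addr0.
Qed.

Lemma tr_mid : \tr mid = 1.
Proof.
rewrite /mxtrace (bigD1 mid_ord) //= dgmE !eqxx big1 ?addr0 // => a.
by rewrite dgmE mid_ordP => /negbTE ->; rewrite mul0rn.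
Qed.

Lemma ptr_gen_upp X : ptr (gen *m upp X) = ptr (gen *m X).
Proof.
rewrite uppE mulmxBr ptrB [ptr (gen *m low X)]ptr_L ?subr0 //.
exact/gradedDL/part_graded/gen_D.
Qed.

Lemma ptr_low_gen X : ptr (low X *m gen) = 0.
Proof. by apply: ptr_L; apply/gradedLD/gen_D/part_graded. Qed.

(** Together with [ptr_gen_pencil]: the pair (t, s) of scalars of a diagonal block becomes (- w^-1
    s, - w [gen_sq] t), so two applications multiply it by [gen_sq]. *)
Lemma ptr_pencil X : ptr (pencil X) = - w^-1 *: ptr (gen *m X).
Proof.
rewrite /pencil /corr !ptrB ptrD !ptrZ ptr_gen_upp ptr_low_gen ptr_ptr_gen ptr_ptr ptr_mid.
by mxring.
Qed.

Lemma ptr_gen_pencil X : ptr (gen *m pencil X) = - (w * gen_sq) *: ptr X.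
Proof.
have p0 : ptr (gen *m (low X *m gen)) = 0.
  apply: ptr_L; apply: gradedDL; [exact: gen_D|apply/gradedLD/gen_D/part_graded].
have pl : ptr (low X) = 0 by apply/ptr_L/part_graded.
have pg : ptr (gen *m ptr (gen *m X)) = 0.
  by rewrite -(ptr_comm (gen *m X) gen_D) ptr_ptr_gen.
rewrite /pencil /corr uppE (ptr_comm X gen_D) !(mulmxBr, mulmxDr, mulmxN) -!scalemxAr.
rewrite !(ptrB, ptrD, ptrN, ptrZ) p0 pg gen_mid ptr0 !mulmxA !ptr_gen_gen pl ptr_ptr.
by mxring.
Qed.

Lemma tr_pencil X : \tr (pencil X) = 0.
Proof.
have [ptrX tr_low] : \tr (ptr X *m gen) = 0 /\ \tr (low X *m gen) = 0.
  split; last by apply: tr_offdiag => a; rewrite (gradedLD _ gen_D) ?ltnn //; exact: part_graded.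
  by rewrite mxtrace_mulC tr_gen -(ptr_comm X gen_D) ptr_ptr_gen mxtrace0.
have tr_upp : \tr (gen *m upp X) = \tr (gen *m X) by rewrite !tr_gen ptr_gen_upp.
rewrite /pencil /corr !linearB /= linearD /= !linearZ /= tr_mid ptrX tr_low tr_upp -tr_gen.
by ring.
Qed.

(** Off the middle entry this is z^2 = [gen_sq], acting from the left or from the right. The middle
    entry is then forced by the vanishing of the trace, which produces the term in [mid]. *)
Lemma pencil_sqr X : pencil (pencil X) = gen_sq *: (X - \tr X *: mid).
Proof.
have lowp : low (pencil X) = - (low X *m gen).
  have := low_D (@corr_D X); rewrite /pencil; move: (corr X) => cX lc.
  have ll : low (low X) = low X by apply/low_id/part_graded.
  by rewrite !lowB lc subr0 (lowDl _ gen_D) (lowDr _ gen_D) uppE lowB ll subrr mulmx0 sub0r.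
have trp : \tr (gen *m pencil X) = - (w * gen_sq) * (\tr X - X mid_ord mid_ord).
  by rewrite tr_gen ptr_gen_pencil linearZ /= tr_ptr.
have zl : low X *m gen *m gen = gen_sq *: low X by apply/gen_gen_L/part_graded.
(* [gen *m gen] erases the middle row; in [upp X] that row has at most its diagonal entry, because
   no level exceeds k. *)
have zu : gen *m (gen *m upp X) = gen_sq *: (upp X - X mid_ord mid_ord *: mid).
  rewrite mulmxA gen_gen -scalemxAl mulmxBl mul1mx; congr (_ *: (_ - _)).
  apply/matrixP => a b; rewrite dgmMl scalemxE dgmE mxE.
  case: eqP => [ak|]; last by rewrite mul0r mul0rn mulr0.
  have /eqP la : lev a == k by rewrite lev_mid ak.
  have /eqP ea : a == mid_ord by rewrite -mid_ordP ak.
  rewrite la mul1r; case: ltngtP (lev_max b) => // kb _.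
    by rewrite [a == b](_ : _ = false) ?mulr0n ?mulr0 //; apply: contraTF kb => /eqP <-;
       rewrite la ltnn.
  have /eqP -> : b == mid_ord by rewrite -mid_ordP -lev_mid kb.
  by rewrite ea eqxx mulr1.
have upPP : upp (pencil X) = gen *m upp X - corr X.
  by rewrite uppE lowp opprK /pencil; move: (corr X) => cX; mxring.
rewrite {1}/pencil upPP lowp [corr (pencil X)]/corr ptr_pencil ptr_gen_pencil trp.
have zc : gen *m corr X = (1 + w) *: (gen_sq *: ptr X) + (1 + w^-1) *: (ptr (gen *m X) *m gen).
  rewrite /corr mulmxBr mulmxDr -!scalemxAr gen_mid scaler0 subr0.
  rewrite (ptr_comm X gen_D) (ptr_comm (gen *m X) gen_D) mulmxA gen_gen -scalemxAl mulmxBl.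
  by rewrite mul1mx (mid_comm (@ptr_D X)) mul_ptr_mid subr0.
rewrite mulmxBr zu mulNmx zl zc uppE -scalemxAl.
by apply/matrixP => ? ?; rewrite ?(addmxE, oppmxE, scalemxE); field.
Qed.

End Generator.

Lemma gen_add al be ga al' be' ga' :
  gen (al + al') (be + be') (ga + ga') = gen al be ga + gen al' be' ga'.
Proof.
apply/matrixP => a b; rewrite !mxE.
by case: ltngtP => _; rewrite ?mul0rn ?addr0 // !mulrnDl ?opprD ?mulrnDl; ring.
Qed.

Lemma pencil_gen_add al be ga al' be' ga' w X :
  pencil (al + al') (be + be') (ga + ga') w X = pencil al be ga w X + pencil al' be' ga' w X.
Proof. by rewrite /pencil /corr gen_add !mulmxDl linearD /= ptrD; mxring. Qed.

(* Polarisation of [pencil_sqr]. *)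
Lemma pencil_anticomm al be ga al' be' ga' w X : w != 0 -> \tr X = 0 ->
  2 * al * al' + be * ga' + be' * ga = 0 ->
  pencil al be ga w (pencil al' be' ga' w X) = - pencil al' be' ga' w (pencil al be ga w X).
Proof.
move=> w0 X0 orth; have := pencil_sqr (al + al') (be + be') (ga + ga') w0 X.
rewrite !pencil_gen_add.
rewrite (pencilD al be ga w (pencil _ _ _ _ X)) (pencilD al' be' ga' w (pencil _ _ _ _ X)).
rewrite !pencil_sqr // X0 scale0r subr0.
(* The hypothesis [orth] says tr(z z') = 0: the quadratic form [gen_sq] is additive on the pair, so
   the cross terms of the square cancel. *)
have -> : gen_sq (al + al') (be + be') (ga + ga') = gen_sq al be ga + gen_sq al' be' ga'.
  by rewrite /gen_sq -[RHS]addr0 -orth; ring.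
move: (pencil _ _ _ _ (pencil al' _ _ _ _)) (pencil _ _ _ _ (pencil al _ _ _ _)) => A B.
move=> E; apply/eqP; rewrite -subr_eq0 opprK; apply/eqP; move/matrixP: E => E.
apply/matrixP => a b; have := E a b; rewrite !(addmxE, scalemxE, zeromxE) => {}E.
by apply: (addrI ((gen_sq al be ga + gen_sq al' be' ga') * X a b)); rewrite addr0 -{2}E; ring.
Qed.

(** Polarised Cayley-Hamilton identity for 2 x 2 matrices: z A + A z = tr(A) z + tr(z A) when z is
    traceless, read with half traces. It compares left multiplication by z on a diagonal block with
    minus right multiplication. *)
Lemma gen_anticomm al be ga X : isD X -> gen al be ga *m X + X *m gen al be ga =
  2 *: (ptr X *m gen al be ga) + 2 *: ptr (gen al be ga *m X).
Proof.
move=> DX; apply/matrixP => a b; rewrite !addmxE !scalemxE ptrE !genMl !dgmMl.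
have [ak|ak] := eqVneq (a : nat) k.
  rewrite [(X *m _) a b]mxE big1 => [|c _]; last first.
    have [<-|nac] := eqVneq a c; first by rewrite mxE ak ltnn !mul0rn addr0 mulr0.
    rewrite DX ?mul0r // lev_eq (negbTE nac) /= -(inj_eq rev_ord_inj) rev_ordK.
    by rewrite (eqP (_ : rev_ord a == a)) // rev_ord_eq ak.
  by rewrite ak ltnn !mul0r mul0rn; ring.
have ra : (rev_ord a == a) = false by rewrite rev_ord_eq (negbTE ak).
have ar : (a == rev_ord a) = false by rewrite eq_sym.
have rk : (rev_ord a < k)%N = (k < a)%N by have := ltn_ord a; rewrite /=; lia.
have kr : (k < rev_ord a)%N = (a < k)%N by have := ltn_ord a; rewrite /=; lia.
have [/eqP|nab] := boolP (lev b == lev a); last first.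
  rewrite eq_sym in nab; have nab' : lev (rev_ord a) != lev b by rewrite lev_rev.
  rewrite (gradedDD DX (gen_D al be ga) nab) (DX _ _ nab) (DX _ _ nab') (gen_D _ _ _ nab).
  by move: nab; rewrite lev_eq negb_or => /andP[/negbTE -> _]; rewrite mulr0n; ring.
move/eqP; rewrite lev_eq => /orP[/eqP->|/eqP->]; rewrite (mulmD_E _ _ (gen_D al be ga)) //;
  rewrite ?rev_ord_mid // !rev_ordK !mxE !eqxx ?ra ?ar ?rk ?kr !rev_ordK ?mulr0n ?mulr1n ?eqxx;
  by move: ak; case: ltngtP => // _ _; rewrite ?ar ?mulr1n ?mulr0n; field.
Qed.

End PencilEndomorphism.

(** * Compatibility with the adjoint of a Hermitian form of signature (k + 1, k) *)

Section AdjointInvolution.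
Context {C : numClosedFieldType} (n k : nat) (hn : n = k.*2.+1).
Implicit Types (X Y : 'M[C]_n).

(** Each plane pairs an index below k with one above k, hence carries one plus and one minus sign: z
    must lie in su(1,1). The extra plus sign sits on the middle vector. *)
Definition sgnD (a : 'I_n) : C := if (a <= k)%N then 1 else -1.

Lemma sgnD_sq a : sgnD a * sgnD a = 1.
Proof. by rewrite /sgnD; case: ifP; rewrite ?mulr1 ?mulrNN ?mulr1. Qed.

(* [D X^* D] for the diagonal form [D] of signature (k + 1, k). *)
Definition adjD X : 'M[C]_n := \matrix_(a, b) (sgnD a * sgnD b * (X b a)^*).

Lemma adjDE X a b : adjD X a b = sgnD a * sgnD b * (X b a)^*.
Proof. by rewrite mxE. Qed.

Lemma adjDM X Y : adjD (X *m Y) = adjD Y *m adjD X.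
Proof.
apply/matrixP => a b; rewrite !mxE rmorph_sum mulr_sumr; apply: eq_bigr => c _.
rewrite !mxE rmorphM.
rewrite [RHS](_ : _ = (sgnD c * sgnD c) * (sgnD a * sgnD b * ((X b c)^* * (Y c a)^* ))).
  by rewrite sgnD_sq mul1r.
ring.
Qed.

Lemma adjDD X Y : adjD (X + Y) = adjD X + adjD Y.
Proof. by apply/matrixP => a b; rewrite !mxE rmorphD mulrDr. Qed.
Lemma adjDZ x X : adjD (x *: X) = x^* *: adjD X.
Proof. by apply/matrixP => a b; rewrite !mxE rmorphM; ring. Qed.
Lemma adjDN X : adjD (- X) = - adjD X.
Proof. by rewrite -scaleN1r adjDZ rmorphN rmorph1 scaleN1r. Qed.

Lemma adjD_diag X a : adjD X a a = (X a a)^*.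
Proof. by rewrite adjDE sgnD_sq mul1r. Qed.

Lemma adjD_dgm (f : 'I_n -> C) : adjD (dgm f) = dgm (fun a => (f a)^*).
Proof.
apply/matrixP => a b; rewrite adjDE !dgmE eq_sym.
have [->|_] := eqVneq a b; last by rewrite !mulr0n rmorph0 mulr0.
by rewrite !mulr1n sgnD_sq mul1r.
Qed.

Lemma adjD_mid : adjD (mid k) = mid k.
Proof.
by rewrite adjD_dgm; apply/matrixP => a b; rewrite !dgmE rmorph_nat.
Qed.

Lemma adjD_ptr X : adjD (ptr k X) = ptr k (adjD X).
Proof.
rewrite adjD_dgm; apply/matrixP => a b; rewrite !dgmE !adjD_diag.
by case: ifP; rewrite ?rmorph0 // rmorphM rmorphD fmorphV rmorph_nat.
Qed.

Lemma tr_adjD X : \tr (adjD X) = (\tr X)^*.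
Proof. by rewrite rmorph_sum; apply: eq_bigr => a _; rewrite adjD_diag. Qed.

Definition dia X : 'M[C]_n := part (fun x y => x == y) X.

Lemma adjD_low X : adjD (low X) = upp (adjD X) - dia (adjD X).
Proof.
apply/matrixP => a b; rewrite !mxE; case: ltngtP => _;
  by rewrite ?rmorph0 ?mulr0 ?subrr ?subr0.
Qed.

Lemma adjD_upp X : adjD (upp X) = low (adjD X) + dia (adjD X).
Proof.
apply/matrixP => a b; rewrite !mxE; case: ltngtP => _;
  by rewrite ?rmorph0 ?mulr0 ?add0r ?addr0.
Qed.

Lemma adjD_gen al be : al^* = - al ->
  adjD (gen k al be (be^*)) = - gen k al be (be^*).
Proof.
move=> alc; apply/matrixP => a b; rewrite adjDE oppmxE !mxE /sgnD [b == a]eq_sym.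
have -> : (rev_ord b == a) = (rev_ord a == b).
  by rewrite -(inj_eq rev_ord_inj) rev_ordK eq_sym.
have [<-|ab] := eqVneq a b.
  have -> : (rev_ord a == a) = (a == k :> nat) by rewrite (rev_ord_eq hn).
  case: ltngtP => _; rewrite ?mulr1n ?mulr0n ?addr0 ?rmorph0 ?mulr0 ?oppr0 ?mul1r //.
  by rewrite mulrNN mulr1 mul1r rmorphN /= alc.
have [<-|rab] := eqVneq (rev_ord a) b; last first.
  by rewrite !mulr0n addr0 rmorph0 mulr0 oppr0.
have rk : (rev_ord a < k)%N = (k < a)%N by have := ltn_ord a; rewrite /=; lia.
have kr : (k < rev_ord a)%N = (a < k)%N by have := ltn_ord a; rewrite /=; lia.
rewrite [(rev_ord a <= k)%N]leqNgt kr rk !mulr0n !mulr1n !add0r.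
case: ltngtP => _ /=; rewrite ?rmorph0 ?mulr0 ?oppr0 //;
  by rewrite ?mulr1 ?mul1r mulN1r //; congr (- _); apply: conjCK.
Qed.

(** [adjD] reverses products, negates [gen] and exchanges the strict triangles, so the off-diagonal
    actions match. A diagonal block comes back multiplied by z on the other side; [gen_anticomm]
    rewrites the difference in terms of [ptr], and the coefficients agree because 1 + w = 1 - w^-1
    and 1 + w^-1 = 1 - w. *)
Lemma adjD_pencil al be w X : al^* = - al -> w != 0 -> w^* = w^-1 -> w + w^-1 = 0 ->
  adjD (pencil k al be (be^*) w X) = pencil k al be (be^*) w (adjD X).
Proof.
move=> alc w0 wc wim; have adjg := adjD_gen be alc.
have wc2 : (w^-1)^* = w by rewrite -wc conjCK.
have two0 : (2 : C) != 0 by rewrite pnatr_eq0.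
have gD := gen_D hn al be (be^*).
have ptrg : ptr k (adjD X *m gen k al be (be^*)) = ptr k (gen k al be (be^*) *m adjD X).
  by rewrite (ptr_cyc hn _ gD).
have Dd : graded (fun x y => x == y) (dia (adjD X)) by exact: part_graded.
have anti := gen_anticomm hn two0 al be (be^*) Dd.
have [ptrd ptrgd] : ptr k (dia (adjD X)) = ptr k (adjD X) /\
    ptr k (gen k al be (be^*) *m dia (adjD X)) = ptr k (gen k al be (be^*) *m adjD X).
  have decY : adjD X = part (fun x y => x < y)%N (adjD X) + dia (adjD X) + low (adjD X).
    by apply/matrixP => a b; rewrite !mxE; case: ltngtP; rewrite ?addr0 ?add0r.
  have UY : graded (fun x y => x < y)%N (part (fun x y => x < y)%N (adjD X)).
    exact: part_graded.
  have LY : graded (fun x y => y < x)%N (low (adjD X)) by exact: part_graded.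
  move: (part _ _) (dia _) (low _) UY LY decY => U D L UY LY ->.
  rewrite !mulmxDr !ptrD (ptr_U k UY) (ptr_L k LY) (ptr_U k (gradedDU gD UY)).
  by rewrite (ptr_L k (gradedDL gD LY)) !add0r !addr0.
rewrite ptrd ptrgd in anti.
rewrite /pencil /corr !(adjDD, adjDN, adjDZ, adjDM) adjD_low adjD_upp !adjD_ptr !adjDM adjg.
rewrite adjD_mid !(mulmxN, mulNmx) !ptrN ptrg !rmorphD rmorph1 !rmorphM /= -tr_adjD adjDM adjg.
rewrite !mulmxN linearN /= mxtrace_mulC wc wc2.
have wE : w^-1 = - w by apply/eqP; rewrite -addr_eq0 addrC wim.
rewrite wE -(ptr_comm hn (adjD X) gD).
move/matrixP: anti => anti; apply/matrixP => a b; have := anti a b.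
rewrite ?(mulmxDl, mulmxBl, mulmxDr, mulmxBr, mulNmx, mulmxN).
rewrite ?(addmxE, oppmxE, scalemxE) => E.

rewrite linearN /=; apply/eqP; rewrite -subr_eq0; apply/eqP.
move/eqP: E; rewrite eq_sym -subr_eq0 => /eqP E; rewrite -[RHS]E; ring.
Qed.

End AdjointInvolution.

(** * Calculus of maps of class C^k between normed spaces *)

Section CkCalculus.
Context {R : realType}.
Implicit Types U V W : normedModType R.

Lemma near0_differentiable V W (h : V -> W) (x : V) :
  (\forall y \near x, h y = 0) -> differentiable h x.
Proof.
move=> h0; apply/diffP.
(* The differential is a chosen linear map, so differentiability follows once some continuous linear
   map meets its specification; the differential of the constant 0 does. *)
apply: (@getPex _ (fun df : {linear V -> W} => continuous df /\
  forall y, h y = h (lim (nbhs x)) + df (y - lim (nbhs x))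
                  +o_(y \near x) (y - lim (nbhs x)))).
exists ('d (cst (0 : W)) x : {linear V -> W}); split.
  by apply: diff_continuous; exact: differentiable_cst.
have : forall e : R, 0 < e -> \forall y \near x, `|(h - cst 0) y| <= e * `|center x y|.
  move=> e e0; apply: filterS h0 => y hy.
  by rewrite !fctE hy subrr normr0 mulr_ge0 // ltW.
move=> /(@eqaddoP R _ _ _ (nbhs_filter_on x) h (cst 0) (center x)) /funeqP E.
apply: eqaddoEx => y; rewrite lim_id //= diff_cst /= (nbhs_singleton h0) add0r.
exact: E.
Qed.

Lemma near_eq_differentiable V W (f g : V -> W) (x : V) :
  (\forall y \near x, f y = g y) -> differentiable f x -> differentiable g x.
Proof.
move=> fg df; rewrite -[g](subrK f); apply: differentiableD => //.
by apply: near0_differentiable; apply: filterS fg => y fgy; rewrite !fctE fgy subrr.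
Qed.

Lemma open_near_eq V (T : Type) (A : set V) (f g : V -> T) x :
  open A -> A x -> (forall y, A y -> f y = g y) -> \forall y \near x, f y = g y.
Proof.
move=> oA Ax fg; have : nbhs x A by exact: open_nbhs_nbhs.
by apply: filterS => y /fg.
Qed.

Lemma Ck_ext V W k (A : set V) (f g : V -> W) :
  open A -> (forall x, A x -> f x = g x) -> Ck k A f -> Ck k A g.
Proof.
move=> oA; elim: k f g => [|k IH] f g fg /=.
  move=> cf x Ax; have nfg := open_near_eq oA Ax fg.
  rewrite /prop_for /continuous_at -(fg _ Ax); apply: cvg_trans (cf x Ax).
  by apply: near_eq_cvg; apply: filterS nfg.
move=> [df Df]; split=> [x Ax|v].
  exact: near_eq_differentiable (open_near_eq oA Ax fg) (df _ Ax).
apply: IH (Df v) => x Ax; apply: near_eq_derive.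
exact: open_near_eq oA Ax fg.
Qed.

Lemma CkS V W k (A : set V) (f : V -> W) : Ck k.+1 A f -> Ck k A f.
Proof.
elim: k f => [|k IH] f.
  by move=> [df _] x Ax; exact/differentiable_continuous/df.
by move=> [df Df]; split=> // v; exact/IH/Df.
Qed.

Lemma Ck_cst V W k (A : set V) (a : W) : Ck k A (cst a).
Proof.
elim: k a => [|k IH] a /=; first by move=> x _; exact: cst_continuous.
split=> [x _|v]; first exact: differentiable_cst.
by rewrite (_ : (fun x => _) = cst 0) //; apply/funext => x; rewrite derive_cst.
Qed.

Lemma Ck_add V W k (A : set V) (f g : V -> W) :
  open A -> Ck k A f -> Ck k A g -> Ck k A (f \+ g).
Proof.
move=> oA; elim: k f g => [|k IH] f g.
  by move=> cf cg x Ax; apply: cvgD; [exact: cf|exact: cg].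
move=> [df Df] [dg Dg]; split=> [x Ax|v].
  by apply: differentiableD; [exact: df|exact: dg].
apply: (Ck_ext oA) (IH _ _ (Df v) (Dg v)) => x Ax /=.
by rewrite deriveD //; apply: diff_derivable; [exact: df|exact: dg].
Qed.

Lemma Ck_sum V W k (A : set V) (I : Type) (r : seq I) (P : pred I) (f : I -> V -> W) :
  open A -> (forall i, P i -> Ck k A (f i)) ->
  Ck k A (fun x => \sum_(i <- r | P i) f i x).
Proof.
move=> oA Cf; elim: r => [|i r IH].
  by apply: Ck_ext (Ck_cst _ _ 0) => // x _; rewrite big_nil.
case Pi : (P i).
  by apply: Ck_ext (Ck_add oA (Cf _ Pi) IH) => // x _; rewrite big_cons Pi.
by apply: Ck_ext IH => // x _; rewrite big_cons Pi.
Qed.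

Section Bilinear.
Context {U V W : normedModType R} (B : U -> V -> W).
Hypothesis linl : forall v, linear (B^~ v).
Hypothesis linr : forall u, linear (B u).
Hypothesis contB : continuous (fun p : U * V => B p.1 p.2).

Lemma bilin_diff (X : normedModType R) (f : X -> U) (g : X -> V) (x : X) :
  differentiable f x -> differentiable g x ->
  differentiable (fun y => B (f y) (g y)) x /\
  forall v, 'D_v (fun y => B (f y) (g y)) x = B ('D_v f x) (g x) + B (f x) ('D_v g x).
Proof.
move=> df dg.
have bil : bilinear_for (GRing.Scale.Law.clone _ _ *:%R _) (GRing.Scale.Law.clone _ _ *:%R _) B.
  by split => [u' a u v|u a v v']; [exact: linl|exact: linr].
pose BM := bilinear_isBilinear.Build R U V W _ _ B bil.
pose BB : {bilinear U -> V -> W} := HB.pack B BM.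
have dB p : differentiable (fun p : U * V => BB p.1 p.2) p by exact: differentiable_bilin.
have DB p : 'd (fun q : U * V => B q.1 q.2) p = (fun q => B p.1 q.2 + B q.1 p.2) :> (U * V -> W).
  exact: (diff_bilin (f := BB)).
have dfg : differentiable (fun y => (f y, g y)) x by exact: differentiable_pair.
have dBfg := differentiable_comp dfg (dB (f x, g x)).
split=> [//|v]; rewrite deriveE //.
rewrite -[fun y => _]/((fun p : U * V => BB p.1 p.2) \o (fun y => (f y, g y))).
rewrite diff_comp //= DB diff_pair //= addrC.
by rewrite -!deriveE.
Qed.

Lemma Ck_bilin (X : normedModType R) k (A : set X) (f : X -> U) (g : X -> V) :
  open A -> Ck k A f -> Ck k A g -> Ck k A (fun x => B (f x) (g x)).
Proof.
move=> oA; elim: k f g => [|k IH] f g.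
  move=> cf cg x Ax.
  apply: (@continuous_comp _ _ _ (fun y => (f y, g y)) (fun p => B p.1 p.2)); last exact: contB.
  by apply: cvg_pair; [exact: cf|exact: cg].
move=> Cf Cg; have [df Df] := Cf; have [dg Dg] := Cg; split=> [x Ax|v].
  by have [] := bilin_diff (df _ Ax) (dg _ Ax).
have := Ck_add oA (IH _ _ (Df v) (CkS Cg)) (IH _ _ (CkS Cf) (Dg v)).
apply: Ck_ext => // x Ax /=.
by have [_ ->] := bilin_diff (df _ Ax) (dg _ Ax).
Qed.

End Bilinear.

Section Linear.
Context {V W : normedModType R} (L : V -> W).
Hypothesis linL : linear L.
Hypothesis contL : continuous L.

Lemma lin_diff (x : V) : differentiable L x /\ forall v, 'D_v L x = L v.
Proof.
pose LM := GRing.isLinear.Build R V W _ L linL.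
pose LL : {linear V -> W} := HB.pack L LM.
have dL : differentiable LL x by exact: linear_differentiable.
by split=> // v; rewrite deriveE //= (diff_lin (f := LL)).
Qed.

Lemma Ck_lin k (A : set V) : Ck k A L.
Proof.
case: k => [|k]; first by move=> x _; exact: contL.
split=> [x _|v]; first by have [] := lin_diff x.
rewrite (_ : (fun x => _) = cst (L v)); first exact: Ck_cst.
by apply/funext => x; have [_ ->] := lin_diff x.
Qed.

Lemma lin_comp_diff (X : normedModType R) (f : X -> V) (x : X) : differentiable f x ->
  differentiable (L \o f) x /\ forall v, 'D_v (L \o f) x = L ('D_v f x).
Proof.
move=> df; have [dL DL] := lin_diff (f x).
have dLf := differentiable_comp df dL.
by split=> // v; rewrite !deriveE // diff_comp //= -deriveE // DL.
Qed.

Lemma Ck_lin_comp (X : normedModType R) k (A : set X) (f : X -> V) :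
  open A -> Ck k A f -> Ck k A (L \o f).
Proof.
move=> oA; elim: k f => [|k IH] f.
  by move=> cf x Ax; apply: continuous_comp; [exact: cf|exact: contL].
move=> [df Df]; split=> [x Ax|v]; first by have [] := lin_comp_diff (df _ Ax).
apply: Ck_ext (IH _ (Df v)) => // x Ax /=.
by have [_ ->] := lin_comp_diff (df _ Ax).
Qed.

End Linear.

Lemma Ck_mul (X : normedModType R) k (A : set X) (f g : X -> R) :
  open A -> Ck k A f -> Ck k A g -> Ck k A (fun x => f x * g x).
Proof.
apply: (@Ck_bilin R R R *%R) => [v a u u'|u a v v'|].
- by rewrite /= mulrDl -scalerAl.
- by rewrite mulrDr -scalerAr.
- by move=> p; exact: mul_continuous.
Qed.

Lemma Ck_scale (X W : normedModType R) k (A : set X) (f : X -> R) (g : X -> W) :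
  open A -> Ck k A f -> Ck k A g -> Ck k A (fun x => f x *: g x).
Proof.
apply: (@Ck_bilin R W W *:%R) => [v a u u'|u a v v'|].
- by rewrite /= scalerDl scalerA.
- by rewrite scalerDr !scalerA mulrC.
- by move=> p; exact: scale_continuous.
Qed.

Lemma Ck_inv (X : normedModType R) k (A : set X) (f : X -> R) :
  open A -> (forall x, A x -> f x != 0) -> Ck k A f -> Ck k A (fun x => (f x)^-1).
Proof.
move=> oA f0; elim: k => [|k IH].
  by move=> cf x Ax; apply: cvgV; [exact: f0|exact: cf].
move=> Cf; have [df Df] := Cf; have IHf := IH (CkS Cf); split=> [x Ax|v].
  by apply: differentiableV; [exact: df|exact: f0].
have := Ck_mul oA (@Ck_cst X R k A (-1 : R)) (Ck_mul oA (Df v) (Ck_mul oA IHf IHf)).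
apply: Ck_ext => // x Ax.
rewrite deriveV; [|exact: f0|exact/diff_derivable/df].
by rewrite -[_ *: _]/(_ * _) /= -invfM -expr2 mulN1r mulrC mulNr.
Qed.

End CkCalculus.

(** * Curves, tangent vectors and differentials along a subset *)

Section Curves.
Context {R : realType}.

Lemma curve_at_lin (V W : normedModType R) (M : set V) (N : set W) (L : V -> W) p v c :
  linear L -> continuous L -> (forall x, M x -> N (L x)) ->
  curve_at M p v c -> curve_at N (L p) (L v) (L \o c).
Proof.
move=> linL cL MN [c0 cv [U [U0 [oU CkU] UM]]].
have dc : differentiable c 0 by have [] := CkU 1%N; move=> /(_ 0 U0).
split; first by rewrite /= c0.
  have [_ D] := lin_comp_diff linL cL dc.
  by rewrite derive1E D -derive1E cv.
exists U; split=> // [|t Ut]; last exact/MN/UM.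
by split=> // k; exact: Ck_lin_comp.
Qed.

Lemma curve_at_differentiable (V : normedModType R) (M : set V) p v c :
  curve_at M p v c -> differentiable c 0 /\ \forall t \near 0, M (c t).
Proof.
move=> [_ _ [U [U0 [oU CkU] UM]]]; split.
  by have [] := CkU 1%N; move=> /(_ 0 U0).
have : nbhs (0 : R) U by exact: open_nbhs_nbhs.
by apply: filterS => t /UM.
Qed.

Lemma derive1_curve (V W : normedModType R) (M : set V) (F : V -> W) p v c :
  curve_at M p v c -> differentiable F p -> derive1 (F \o c) 0 = 'D_v F p.
Proof.
move=> cc dF; have [dc _] := curve_at_differentiable cc.
have [c0 cv _] := cc; have dF0 : differentiable F (c 0) by rewrite c0.
rewrite (derive1E' (differentiable_comp dc dF0)) (diff_comp dc dF0) /=.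
by rewrite -(derive1E' dc) cv c0 -deriveE.
Qed.

Lemma derive1_near (W : normedModType R) (f g : R -> W) :
  (\forall t \near 0, f t = g t) -> derive1 f 0 = derive1 g 0.
Proof. by move=> fg; rewrite !derive1E; exact: near_eq_derive. Qed.

(** [tdiff] uses an arbitrarily chosen curve. By the chain rule every admissible curve gives the
    directional derivative of an ambient extension, so the choice does not matter. *)
Lemma tdiff_eq (V W : normedModType R) (M : set V) (f F : V -> W) p v (A : set V) :
  open A -> A p -> (forall x, A x -> M x -> f x = F x) ->
  differentiable F p -> tangent M p v -> tdiff M f p v = 'D_v F p.
Proof.
move=> oA Ap fF dF tv; rewrite /tdiff.
(* Tangency of [v] provides a curve, so [xget] does not fall back on its default [cst p]. *)
have cc : curve_at M p v (xget (cst p) [set c | curve_at M p v c]) by exact: xgetPex.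
move: (xget _ _) cc => c cc; have [dc cM] := curve_at_differentiable cc.
rewrite -(derive1_curve cc dF); apply: derive1_near.
have cA : \forall t \near 0, A (c t).
  apply: (differentiable_continuous dc); have [-> _ _] := cc; exact: open_nbhs_nbhs.
by apply: filterS2 cM cA => t Mt At; exact: fF.
Qed.

Lemma tdiff_lin (V W : normedModType R) (M : set V) (L : V -> W) p v :
  linear L -> continuous L -> tangent M p v -> tdiff M L p v = L v.
Proof.
move=> linL cL tv; have [dL DL] := lin_diff linL cL p.
by rewrite (@tdiff_eq _ _ M L L p v setT) //; exact: openT.
Qed.

Lemma Ck_comp_lin (V W X : normedModType R) (L : X -> V) k (f : V -> W) :
  linear L -> continuous L -> Ck k setT f -> Ck k setT (f \o L).
Proof.
move=> linL cL; elim: k f => [|k IH] f.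
  by move=> cf x _; apply: continuous_comp; [exact: cL|exact: cf].
move=> [df Df]; split=> [x _|v].
  by apply: differentiable_comp; [have [] := lin_diff linL cL x|exact: df].
apply: Ck_ext (IH _ (Df (L v))) => [|x _ /=]; first exact: openT.
have [dL DL] := lin_diff linL cL x.
rewrite [RHS]deriveE; last by apply: differentiable_comp => //; exact: df.
by rewrite diff_comp //= ?deriveE // -?DL ?deriveE //; exact: df.
Qed.

End Curves.

(** * Left-invariant tensors on a group with bilinear multiplication and Lie algebra ker L *)

Section LeftInvariant.
Context {R : realType} {V W : normedModType R}.
Context (mul : V -> V -> V) (inv : V -> V) (one : V) (G : set V) (L : V -> W).
Hypothesis mulA : associative mul.
Hypothesis mul1x : left_id one mul.
Hypothesis linl : forall v, linear (mul^~ v).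
Hypothesis linr : forall u, linear (mul u).
Hypothesis contm : continuous (fun p : V * V => mul p.1 p.2).
Hypothesis Gmul : forall g h, G g -> G h -> G (mul g h).
Hypothesis Ginv : forall g, G g -> G (inv g).
Hypothesis mulVx : forall g, G g -> mul (inv g) g = one.
Hypothesis mulxV : forall g, G g -> mul g (inv g) = one.
Hypothesis smooth_inv : forall k, Ck k setT inv.
Hypothesis linL : linear L.
Hypothesis contL : continuous L.
Hypothesis tangent1 : forall v, tangent G one v <-> L v = 0.

Local Notation "x ** y" := (mul x y) (at level 40, left associativity).

Lemma cont_mulr u : continuous (mul u).
Proof.
move=> v; apply: (@continuous_comp _ _ _ (fun y => (u, y)) (fun p => mul p.1 p.2)).
  by apply: cvg_pair; [exact: cvg_cst|exact: cvg_id].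
exact: contm.
Qed.

Lemma mulKx g x : G g -> inv g ** (g ** x) = x.
Proof. by move=> Gg; rewrite mulA mulVx // mul1x. Qed.
Lemma mulVKx g x : G g -> g ** (inv g ** x) = x.
Proof. by move=> Gg; rewrite mulA mulxV // mul1x. Qed.

Lemma mulDr u x y : u ** (x + y) = u ** x + u ** y.
Proof. by have := linr u 1 x y; rewrite !scale1r. Qed.
Lemma mulx0 u : u ** 0 = 0.
Proof. by have := linr u (-1) 0 0; rewrite scaler0 addr0 scaleN1r addNr. Qed.
Lemma mulZr u a x : u ** (a *: x) = a *: (u ** x).
Proof. by have := linr u a x 0; rewrite mulx0 !addr0. Qed.
Lemma mulxN u x : u ** (- x) = - (u ** x).
Proof. by rewrite -scaleN1r mulZr scaleN1r. Qed.
Lemma mulBr u x y : u ** (x - y) = u ** x - u ** y.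
Proof. by rewrite mulDr mulxN. Qed.

(** Left translations are restrictions of continuous linear maps of the ambient space, so they and
    their inverses carry curves to curves. *)
Lemma tangent_mul g x : G g -> tangent G g (g ** x) <-> L x = 0.
Proof.
move=> Gg; rewrite -tangent1; split=> -[c cc].
  exists (mul (inv g) \o c); have GG h : G h -> G (inv g ** h).
    by apply: Gmul; exact: Ginv.
  have := curve_at_lin (linr (inv g)) (@cont_mulr (inv g)) GG cc.
  by rewrite mulVx // mulKx.
exists (mul g \o c); have GG h : G h -> G (g ** h) by exact: Gmul.
have := curve_at_lin (linr g) (@cont_mulr g) GG cc.
by rewrite -{1}(mulVx Gg) mulVKx.
Qed.

Lemma tangentE g v : G g -> tangent G g v <-> L (inv g ** v) = 0.
Proof. by move=> Gg; rewrite -(tangent_mul _ Gg) mulVKx. Qed.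

Definition left_ext (P0 : V -> V) (p v : V) : V := p ** P0 (inv p ** v).

(* The value and differential at [p] of the field [X] read in the left
   trivialisation; the terms in [dx] cancel in the Nijenhuis tensor. *)
Definition field_at (X : V -> V) p x (dx : V -> V) :=
  [/\ X p = p ** x, L x = 0 & forall v, tangent G p v ->
    [/\ L (dx v) = 0, tdiff G X p v = v ** x + p ** dx v &
     forall P0, linear P0 -> continuous P0 ->
       tdiff G (app (left_ext P0) X) p v = v ** P0 x + p ** P0 (dx v)]].

(** With xi = q^-1 X(q), the field is q xi(q), and the Leibniz rule gives its differential. Along
    the group xi takes values in ker L, hence so does its derivative in tangent directions. *)
Lemma vector_field_at X p : vector_field G X -> G p -> exists x dx, field_at X p x dx.
Proof.
move=> [tX sX] Gp; have [U [g [Up [oU Ckg] Xg]]] := sX p Gp.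
pose xi q := inv q ** g q.
have dinv q : differentiable inv q by have [d _] := smooth_inv 1%N; exact: d.
have dg : differentiable g p by have [d _] := Ckg 1%N; exact: d.
have dxi : differentiable xi p by have [] := bilin_diff linl linr contm (dinv p) dg.
have gE : g p = X p by rewrite Xg.
exists (xi p), (fun v => 'D_v xi p); split.
- by rewrite /xi mulVKx // gE.
- by rewrite /xi gE -tangentE //; exact: tX.
move=> v tv.
have did : differentiable id p by [].
have [dF DF] : differentiable (fun q => q ** xi q) p /\ forall v,
    'D_v (fun q => q ** xi q) p = v ** xi p + p ** 'D_v xi p.
  have [d1 d2] := bilin_diff linl linr contm did dxi; split=> // u.
  by rewrite d2 derive_id.
split.
- have [c cc] := tv; rewrite -(derive1_curve cc dxi).
  have [dc cG] := curve_at_differentiable cc.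
  have dxc : differentiable (xi \o c) 0.
    by apply: differentiable_comp => //; have [-> _ _] := cc.
  have [_ D] := lin_comp_diff linL contL dxc.
  rewrite derive1E -D -derive1E -(derive1_cst (0 : W) (0 : R)); apply: derive1_near.
  have cU : \forall t \near 0, U (c t).
    apply: (differentiable_continuous dc); have [-> _ _] := cc; exact: open_nbhs_nbhs.
  apply: filterS2 cG cU => t Gt Ut /=.
  by rewrite /xi -Xg //; apply/tangentE => //; exact: tX.
- rewrite -DF; apply: (tdiff_eq oU Up) => // q Uq Gq.
  by rewrite /xi mulVKx // Xg.
- move=> P0 linP cP; have [dP DP] := lin_comp_diff linP cP dxi.
  have [dH DH] := bilin_diff linl linr contm did dP.
  rewrite -DP -[v in v ** _](derive_id p v) -DH; apply: (tdiff_eq oU Up) => // q Uq Gq.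
  by rewrite /app /left_ext /xi Xg.
Qed.

Section Invariant.
Context (P0 : V -> V).
Hypothesis linP : linear P0.
Hypothesis contP : continuous P0.
Hypothesis kerP : forall x, L x = 0 -> L (P0 x) = 0.

Local Notation P := (left_ext P0).

Lemma linPD x y : P0 (x + y) = P0 x + P0 y.
Proof. by have := linP 1 x y; rewrite !scale1r. Qed.
Lemma linP0 : P0 0 = 0.
Proof. by have := linP (-1) 0 0; rewrite scaler0 addr0 scaleN1r addNr. Qed.
Lemma linPN x : P0 (- x) = - P0 x.
Proof. by have := linP (-1) x 0; rewrite linP0 !addr0 !scaleN1r. Qed.

Lemma left_ext_tangent p v : G p -> tangent G p v -> tangent G p (P p v).
Proof.
by move=> Gp /(tangentE _ Gp) Lv; apply/tangent_mul => //; exact: kerP.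
Qed.

Lemma left_ext_smooth : smooth_tangent_endo G P.
Proof.
split; first exact: left_ext_tangent.
  by move=> p a u v Gp _ _; rewrite /left_ext linr linP linr.
(* As [inv] is smooth on the whole space, the defining formula is its own smooth extension. *)
move=> q _; exists setT, (fun q : V * V => P q.1 q.2); split=> //; split; first exact: openT.
move=> k; have oT : open (@setT (V * V)%type) by exact: openT.
have lf : linear (fst : V * V -> V) by [].
have ls : linear (snd : V * V -> V) by [].
have cf : continuous (fst : V * V -> V) by move=> ?; exact: cvg_fst.
have cs : continuous (snd : V * V -> V) by move=> ?; exact: cvg_snd.
have C1 := Ck_lin lf cf k setT.
have C2 := Ck_comp_lin lf cf (smooth_inv k).
have C3 := Ck_bilin linl linr contm oT C2 (Ck_lin ls cs k setT).
exact: (Ck_bilin linl linr contm oT C1 (Ck_lin_comp linP contP oT C3)).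
Qed.

Lemma left_ext_invariant : left_invariant G mul P.
Proof.
move=> g h v Gg Gh tv.
have tPv := left_ext_tangent Gh tv.
rewrite (tdiff_lin (linr g) (@cont_mulr g) tv) (tdiff_lin (linr g) (@cont_mulr g) tPv).
rewrite /left_ext [RHS]mulA; congr (_ ** _); congr P0.
have Gi : G (g ** h) by exact: Gmul.
have -> : g ** v = (g ** h) ** (inv h ** v) by rewrite -mulA mulVKx.
by rewrite mulKx.
Qed.

(** [kap] is 1 for P and -1 for J. In the trivialisation each bracket is an algebraic commutator
    plus a difference of derivatives of the coefficients. [P0] composed with itself meets only the
    derivatives [b1] and [b2], which lie in ker L; replacing it there by [kap] makes all derivative
    terms cancel. *)
Lemma left_ext_nijenhuis (kap : R) :
  (forall x, L x = 0 -> P0 (P0 x) = kap *: x) ->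
  (forall x y, L x = 0 -> L y = 0 ->
    (P0 x ** P0 y - P0 y ** P0 x) + kap *: (x ** y - y ** x)
    - P0 (P0 x ** y - y ** P0 x) - P0 (x ** P0 y - P0 y ** x) = 0) ->
  forall X Y, vector_field G X -> vector_field G Y -> forall p, G p ->
    lie_bracket G (app P X) (app P Y) p + kap *: lie_bracket G X Y p
      - P p (lie_bracket G (app P X) Y p) - P p (lie_bracket G X (app P Y) p) = 0.
Proof.
move=> PP NP X Y vX vY p Gp.
have [x [dx fX]] := vector_field_at vX Gp.
have [y [dy fY]] := vector_field_at vY Gp.
move: fX fY => [Xp Lx tX] [Yp Ly tY].
have tang z : L z = 0 -> tangent G p (p ** z) by move=> ?; apply/tangent_mul.
have PM z : P p (p ** z) = p ** P0 z by rewrite /left_ext mulKx.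
have PX : app P X p = p ** P0 x by rewrite /app Xp PM.
have PY : app P Y p = p ** P0 y by rewrite /app Yp PM.
have [LPx LPy] := (kerP Lx, kerP Ly).
rewrite /lie_bracket PX PY Xp Yp.
have [Lb2 DX1 /(_ _ linP contP) DX2] := tX _ (tang _ Ly).
have [_ DX3 /(_ _ linP contP) DX4] := tX _ (tang _ LPy).
have [Lb1 DY1 /(_ _ linP contP) DY2] := tY _ (tang _ Lx).
have [_ DY3 /(_ _ linP contP) DY4] := tY _ (tang _ LPx).
rewrite DX1 DX2 DX3 DX4 DY1 DY2 DY3 DY4.
move: (dx (p ** y)) (dx (p ** P0 y)) (dy (p ** x)) (dy (p ** P0 x)) Lb1 Lb2
  => b2 a2 b1 a1 Lb1 Lb2.
have gather u u' w w' : p ** u ** u' + p ** w - (p ** u' ** u + p ** w') =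
    p ** ((u ** u' - u' ** u) + (w - w')).
  by rewrite -!mulA !(mulDr, mulxN) opprD addrACA.
rewrite !gather !PM -mulZr -(mulDr p) -!(mulBr p).
rewrite -[RHS](mulx0 p); congr (_ ** _); rewrite -[RHS](NP x y Lx Ly).
move: (P0 x ** P0 y - _) (x ** y - _) (P0 x ** y - _) (x ** P0 y - _) => A B C D.
rewrite !scalerDr scalerN !linPD !linPN !PP //.
move: (P0 C) (P0 D) (P0 a1) (P0 a2) (kap *: B) (kap *: b1) (kap *: b2)
  => {}C {}D a c {}B b d.
have -> : A + (a - c) + (B + (b - d)) = A + B + ((a - d) + (b - c)).
  by rewrite addrACA; congr (_ + _); rewrite addrACA [- c - d]addrC addrACA.
move: (a - d) (b - c) => u v.
by rewrite (opprD C) addrACA (opprD D) [LHS]addrACA [u + v]addrC addrK subrr addr0.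
Qed.

(** In the translated basis p b_i the tensor has at every p the matrix of [P0] in the basis b_i, so
    its trace is constant. *)
Lemma left_ext_trace (d : nat) (b : 'I_d -> V) :
  (forall v, L v = 0 <-> exists! x : 'rV[R]_d, v = \sum_(i < d) x ord0 i *: b i) ->
  exists t : R, forall p, G p -> has_trace G P p t.
Proof.
move=> basis.
have L0 : L 0 = 0 by have := linL (-1) 0 0; rewrite scaler0 addr0 scaleN1r addNr.
(* Uniqueness of the coordinates of 0 is linear independence of [b]. *)
have [z [z0 z_uniq]] := (basis 0).1 L0.
have zE : z = 0.
  by apply: z_uniq; rewrite big1 // => i _; rewrite mxE scale0r.
have inj0 (x : 'rV[R]_d) : \sum_(i < d) x ord0 i *: b i = 0 -> x = 0.
  by move=> x0; rewrite -zE; apply/esym/z_uniq.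
have Lb j : L (b j) = 0.
  have bE : b j = \sum_(i < d) (delta_mx ord0 j : 'rV[R]_d) ord0 i *: b i.
    rewrite (bigD1 j) //= mxE !eqxx scale1r big1 ?addr0 // => i /negbTE ij.
    by rewrite mxE ij andbF scale0r.
  apply/basis; exists (delta_mx ord0 j); split=> // x xE.
  apply/eqP; rewrite -subr_eq0; apply/eqP/inj0.
  under eq_bigr do rewrite addmxE oppmxE scalerDl scaleNr.
  by rewrite big_split /= sumrN -bE -xE subrr.
have /choice [A AE] : forall j, exists x : 'rV[R]_d, P0 (b j) = \sum_(i < d) x ord0 i *: b i.
  by move=> j; have [x [xE _]] := (basis _).1 (kerP (Lb j)); exists x.
have lin_sum p (x : 'rV[R]_d) :
    p ** (\sum_(i < d) x ord0 i *: b i) = \sum_(i < d) x ord0 i *: (p ** b i).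
  elim/big_rec2: _ => [|i y1 y2 _ <-]; first exact: mulx0.
  by rewrite mulDr mulZr.
exists (\tr (\matrix_(i, j) A j ord0 i)) => p Gp.
exists d, (fun i => p ** b i), (\matrix_(i, j) A j ord0 i); split=> //.
  move=> v; split=> [/(tangentE _ Gp)/basis[x [xE xu]]|[x [xE xu]]].
    exists x; split=> [|y yE]; first by rewrite -lin_sum -xE mulVKx.
    by apply: xu; rewrite yE -lin_sum mulKx.
  apply/tangentE => //; apply/basis; exists x; split=> [|y yE].
    by rewrite xE -lin_sum mulKx.
  by apply: xu; rewrite -lin_sum -yE mulVKx.
move=> j; rewrite /left_ext mulKx // AE lin_sum.
by apply: eq_bigr => i _; rewrite mxE.
Qed.

End Invariant.

Theorem left_invariant_complex_product (P0 J0 : V -> V) (d : nat) (b : 'I_d -> V) :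
  (forall v, L v = 0 <-> exists! x : 'rV[R]_d, v = \sum_(i < d) x ord0 i *: b i) ->
  linear P0 -> continuous P0 -> linear J0 -> continuous J0 ->
  (forall x, L x = 0 -> L (P0 x) = 0) -> (forall x, L x = 0 -> L (J0 x) = 0) ->
  (forall x, L x = 0 -> P0 (P0 x) = x) -> (forall x, L x = 0 -> J0 (J0 x) = - x) ->
  (forall x, L x = 0 -> P0 (J0 x) = - J0 (P0 x)) ->
  (forall x y, L x = 0 -> L y = 0 ->
    (P0 x ** P0 y - P0 y ** P0 x) + (x ** y - y ** x)
    - P0 (P0 x ** y - y ** P0 x) - P0 (x ** P0 y - P0 y ** x) = 0) ->
  (forall x y, L x = 0 -> L y = 0 ->
    (J0 x ** J0 y - J0 y ** J0 x) - (x ** y - y ** x)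
    - J0 (J0 x ** y - y ** J0 x) - J0 (x ** J0 y - J0 y ** x) = 0) ->
  [/\ complex_product_structure G (left_ext P0) (left_ext J0),
      left_invariant G mul (left_ext P0) & left_invariant G mul (left_ext J0)].
Proof.
move=> basis lP cP lJ cJ kP kJ PP JJ PJ NP NJ; split; try exact: left_ext_invariant.
have inv_cancel Q p v : G p -> left_ext Q p (left_ext P0 p v) = p ** Q (P0 (inv p ** v)).
  by move=> Gp; rewrite /left_ext mulKx.
split.
- split; first split.
  + exact: left_ext_smooth.
  + by move=> p v Gp /(tangentE _ Gp) Lv; rewrite /left_ext mulKx // PP // mulVKx.
  + exact: (left_ext_trace kP basis).
  + move=> X Y vX vY p Gp; rewrite -[lie_bracket G X Y p]scale1r.
    apply: left_ext_nijenhuis => // [x Lx|x y Lx Ly]; first by rewrite PP // scale1r.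
    by rewrite scale1r NP.
- split; first exact: left_ext_smooth.
  + by move=> p v Gp /(tangentE _ Gp) Lv; rewrite /left_ext mulKx // JJ // mulxN mulVKx.
  + move=> X Y vX vY p Gp; rewrite -[- lie_bracket G X Y p]scaleN1r.
    apply: left_ext_nijenhuis => // [x Lx|x y Lx Ly]; first by rewrite JJ // scaleN1r.
    by rewrite scaleN1r NJ.
- by move=> p v Gp /(tangentE _ Gp) Lv; rewrite /left_ext !mulKx // PJ // mulxN.
Qed.

End LeftInvariant.

(** * Bases of kernels and automatic continuity in finite dimension *)

Section FiniteDimension.
Context {R : realType}.

Lemma ker_basis (V W : vectType R) (L : V -> W) : linear L ->
  exists d (b : 'I_d -> V), forall v, L v = 0 <->
    exists! x : 'rV[R]_d, v = \sum_(i < d) x ord0 i *: b i.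
Proof.
move=> linL; pose LM := GRing.isLinear.Build R V W _ L linL.
pose LL : {linear V -> W} := HB.pack L LM.
pose K := lker (linfun LL); pose b := vbasis K.
have kerE v : (L v = 0) <-> v \in K.
  rewrite memv_ker lfunE /=; split=> [->|/eqP //]; exact: eqxx.
exists (\dim K), (fun i => b`_i) => v; rewrite kerE; split=> [vK|[x [-> _]]].
  exists (\row_i coord b i v); split.
    by rewrite {1}(coord_vbasis vK); apply: eq_bigr => i _; rewrite mxE.
  move=> x vE; apply/rowP => i; rewrite mxE vE coord_sum_free //.
  exact: basis_free (vbasisP K).
apply: memv_suml => i _; apply: memvZ; apply: vbasis_mem; apply: mem_nth.
by rewrite size_tuple.
Qed.

Lemma Ck_entry (X : normedModType R) m n k (A : set X) (F : X -> 'M[R]_(m, n)) i j :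
  open A -> Ck k A F -> Ck k A (fun x => F x i j).
Proof.
move=> oA; apply: (@Ck_lin_comp R _ R (fun M : 'M[R]_(m, n) => M i j)) => //.
  by move=> a M N; rewrite !mxE.
exact: coord_continuous.
Qed.

Lemma Ck_mx (X : normedModType R) m n k (A : set X) (F : X -> 'M[R]_(m, n)) :
  open A -> (forall i j, Ck k A (fun x => F x i j)) -> Ck k A F.
Proof.
move=> oA CF.
apply: (@Ck_ext _ _ _ k A (fun x => \sum_i \sum_j F x i j *: delta_mx i j)) => // [x _|].
  by rewrite -matrix_sum_delta.
by do 2![apply: Ck_sum => // ? _]; apply: Ck_scale => //; exact: Ck_cst.
Qed.

Lemma Ck_pair (X V W : normedModType R) k (A : set X) (f : X -> V) (g : X -> W) :
  open A -> Ck k A f -> Ck k A g -> Ck k A (fun x => (f x, g x)).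
Proof.
move=> oA Cf Cg.
have l1 : linear (fun v : V => (v, 0 : W)).
  by move=> a u v; congr (_, _); rewrite /= scaler0 addr0.
have l2 : linear (fun w : W => (0 : V, w)).
  by move=> a u v; congr (_, _); rewrite /= scaler0 addr0.
have c1 : continuous (fun v : V => (v, 0 : W)).
  by move=> v; apply: cvg_pair; [exact: cvg_id|exact: cvg_cst].
have c2 : continuous (fun w : W => (0 : V, w)).
  by move=> v; apply: cvg_pair; [exact: cvg_cst|exact: cvg_id].
have := Ck_add oA (Ck_lin_comp l1 c1 oA Cf) (Ck_lin_comp l2 c2 oA Cg).
by apply: Ck_ext => // x _; congr (_, _); rewrite /= ?addr0 ?add0r.
Qed.

Lemma Ck_continuous (V W : normedModType R) (f : V -> W) : Ck 0 setT f -> continuous f.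
Proof. by move=> Cf x; exact: Cf. Qed.

Lemma lin_continuous_mx m n (W : normedModType R) (L : 'M[R]_(m, n) -> W) :
  linear L -> continuous L.
Proof.
move=> linL; pose LM := GRing.isLinear.Build R _ W _ L linL.
pose LL : {linear 'M[R]_(m, n) -> W} := HB.pack L LM.
apply: Ck_continuous; have oT : open (@setT 'M[R]_(m, n)) by exact: openT.
apply: (@Ck_ext R 'M[R]_(m, n) W 0 setT
    (fun x : 'M[R]_(m, n) => \sum_i \sum_j x i j *: LL (delta_mx i j))) => // [x _|].
  rewrite -[L x]/(LL x) [in RHS](matrix_sum_delta x) linear_sum; apply: eq_bigr => i _.
  by rewrite linear_sum; apply: eq_bigr => j _; rewrite linearZ.
do 2![apply: Ck_sum => // ? _]; apply: Ck_scale => //; last exact: Ck_cst.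
by move=> x _; exact: coord_continuous.
Qed.

Lemma lin_continuous_pair (V V' W : normedModType R) (L : V * V' -> W) :
  (forall f : V -> W, linear f -> continuous f) ->
  (forall f : V' -> W, linear f -> continuous f) -> linear L -> continuous L.
Proof.
move=> cV cV' linL; apply: Ck_continuous.
have LD x y : L (x + y) = L x + L y by have := linL 1 x y; rewrite !scale1r.
have l1 : linear (fun v : V => L (v, 0)).
  by move=> a u v; rewrite -linL; congr L; congr (_, _); rewrite /= scaler0 addr0.
have l2 : linear (fun v : V' => L (0, v)).
  by move=> a u v; rewrite -linL; congr L; congr (_, _); rewrite /= scaler0 addr0.
have lf : linear (fst : V * V' -> V) by [].
have ls : linear (snd : V * V' -> V') by [].
have cf : continuous (fst : V * V' -> V) by move=> ?; exact: cvg_fst.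
have cs : continuous (snd : V * V' -> V') by move=> ?; exact: cvg_snd.
have oT : open (@setT (V * V')%type) by exact: openT.
have := Ck_add oT (Ck_lin_comp l1 (cV _ l1) oT (Ck_lin lf cf 0 setT))
  (Ck_lin_comp l2 (cV' _ l2) oT (Ck_lin ls cs 0 setT)).
apply: Ck_ext => // -[x y] _ /=; rewrite -LD; congr L.
by congr (_, _); rewrite /= ?addr0 ?add0r.
Qed.

End FiniteDimension.

(** * Class C^k for complex matrices depending on real parameters *)

Section ComplexCk.
Context {R : realType}.
Implicit Types X : normedModType R.
Local Notation C := R[i].

Lemma ReD (x y : C) : complex.Re (x + y) = complex.Re x + complex.Re y.
Proof. by case: x; case: y. Qed.
Lemma ImD (x y : C) : complex.Im (x + y) = complex.Im x + complex.Im y.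
Proof. by case: x; case: y. Qed.
Lemma ReM (x y : C) : complex.Re (x * y) =
  complex.Re x * complex.Re y - complex.Im x * complex.Im y.
Proof. by case: x; case: y. Qed.
Lemma ImM (x y : C) : complex.Im (x * y) =
  complex.Re x * complex.Im y + complex.Im x * complex.Re y.
Proof. by case: x; case: y. Qed.
Lemma Re_conj (x : C) : complex.Re (x^*)%R = complex.Re x.
Proof. by case: x. Qed.
Lemma Im_conj (x : C) : complex.Im (x^*)%R = - complex.Im x.
Proof. by case: x. Qed.
Lemma complex_ext (x y : C) : complex.Re x = complex.Re y -> complex.Im x = complex.Im y -> x = y.
Proof. by case: x; case: y => ? ? ? ? /= -> ->. Qed.

Definition CkC X k (A : set X) (f : X -> C) :=
  Ck k A (fun x => complex.Re (f x)) /\ Ck k A (fun x => complex.Im (f x)).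

Context {X : normedModType R} (k : nat) (A : set X) (oA : open A).
Implicit Types f g : X -> C.

Lemma CkC_ext f g : (forall x, A x -> f x = g x) -> CkC k A f -> CkC k A g.
Proof. by move=> fg [Cr Ci]; split; [move: Cr|move: Ci]; apply: Ck_ext => // x /fg ->. Qed.

Lemma CkC_cst a : CkC k A (cst a).
Proof. by split; exact: Ck_cst. Qed.

Lemma CkC_add f g : CkC k A f -> CkC k A g -> CkC k A (fun x => f x + g x).
Proof.
move=> [fr fi] [gr gi]; split.
  by apply: Ck_ext (Ck_add oA fr gr) => // x _; rewrite ReD.
by apply: Ck_ext (Ck_add oA fi gi) => // x _; rewrite ImD.
Qed.

Lemma CkC_mul f g : CkC k A f -> CkC k A g -> CkC k A (fun x => f x * g x).
Proof.
move=> [fr fi] [gr gi]; split.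
  apply: Ck_ext (Ck_add oA (Ck_mul oA fr gr)
    (Ck_mul oA (@Ck_cst R X R k A (-1 : R)) (Ck_mul oA fi gi))) => // x _.
  by rewrite ReM /= mulN1r.
by apply: Ck_ext (Ck_add oA (Ck_mul oA fr gi) (Ck_mul oA fi gr)) => // x _; rewrite ImM.
Qed.

Lemma CkC_conj f : CkC k A f -> CkC k A (fun x => (f x)^*).
Proof.
move=> [fr fi]; split.
  by apply: Ck_ext fr => // x _; rewrite Re_conj.
apply: Ck_ext (Ck_mul oA (@Ck_cst R X R k A (-1 : R)) fi) => // x _.
by rewrite Im_conj /= mulN1r.
Qed.

Lemma CkC_inv f : (forall x, A x -> f x != 0) -> CkC k A f -> CkC k A (fun x => (f x)^-1).
Proof.
move=> f0 [fr fi].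
have N0 x : A x -> complex.Re (f x) * complex.Re (f x) + complex.Im (f x) * complex.Im (f x) != 0.
  move=> /f0; case: (f x) => a b /=; rewrite eq_complex /= negb_and.
  by rewrite paddr_eq0 ?sqr_ge0 -?expr2 ?sqr_ge0 // !sqrf_eq0 negb_and.
have CN := Ck_inv oA N0 (Ck_add oA (Ck_mul oA fr fr) (Ck_mul oA fi fi)).
split.
  by apply: Ck_ext (Ck_mul oA fr CN) => // x _; case: (f x) => a b.
apply: Ck_ext (Ck_mul oA (@Ck_cst R X R k A (-1 : R)) (Ck_mul oA fi CN)) => // x _.
by case: (f x) => a b /=; rewrite mulN1r.
Qed.

Lemma CkC_sum (I : Type) (r : seq I) (P : pred I) (f : I -> X -> C) :
  (forall i, P i -> CkC k A (f i)) -> CkC k A (fun x => \sum_(i <- r | P i) f i x).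
Proof.
move=> Cf; elim: r => [|i r IH].
  by apply: CkC_ext (CkC_cst 0) => x _; rewrite big_nil.
case Pi : (P i).
  by apply: CkC_ext (CkC_add (Cf _ Pi) IH) => x _; rewrite big_cons Pi.
by apply: CkC_ext IH => x _; rewrite big_cons Pi.
Qed.

Lemma CkC_prod (I : Type) (r : seq I) (P : pred I) (f : I -> X -> C) :
  (forall i, P i -> CkC k A (f i)) -> CkC k A (fun x => \prod_(i <- r | P i) f i x).
Proof.
move=> Cf; elim: r => [|i r IH].
  by apply: CkC_ext (CkC_cst 1) => x _; rewrite big_nil.
case Pi : (P i).
  by apply: CkC_ext (CkC_mul (Cf _ Pi) IH) => x _; rewrite big_cons Pi.
by apply: CkC_ext IH => x _; rewrite big_cons Pi.
Qed.

Definition CkM m n (Z : X -> 'M[C]_(m, n)) := forall i j, CkC k A (fun x => Z x i j).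

Lemma CkM_ext m n (Z Y : X -> 'M[C]_(m, n)) :
  (forall x, A x -> Z x = Y x) -> CkM Z -> CkM Y.
Proof. by move=> ZY CZ i j; apply: CkC_ext (CZ i j) => x /ZY ->. Qed.

Lemma CkM_cst m n (Z : 'M[C]_(m, n)) : CkM (cst Z).
Proof. by move=> i j; exact: CkC_cst. Qed.

Lemma CkM_add m n (Z Y : X -> 'M[C]_(m, n)) : CkM Z -> CkM Y -> CkM (fun x => Z x + Y x).
Proof. by move=> CZ CY i j; apply: CkC_ext (CkC_add (CZ i j) (CY i j)) => x _; rewrite mxE. Qed.

Lemma CkM_mul m n p (Z : X -> 'M[C]_(m, n)) (Y : X -> 'M[C]_(n, p)) :
  CkM Z -> CkM Y -> CkM (fun x => Z x *m Y x).
Proof.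
move=> CZ CY i j; apply: (@CkC_ext (fun x => \sum_l Z x i l * Y x l j)) => [x _|].
  by rewrite mxE.
by apply: CkC_sum => l _; exact: CkC_mul.
Qed.

Lemma CkM_scale m n f (Z : X -> 'M[C]_(m, n)) :
  CkC k A f -> CkM Z -> CkM (fun x => f x *: Z x).
Proof. by move=> Cf CZ i j; apply: CkC_ext (CkC_mul Cf (CZ i j)) => x _; rewrite mxE. Qed.

Lemma CkM_det n (Z : X -> 'M[C]_n) : CkM Z -> CkC k A (fun x => \det (Z x)).
Proof.
move=> CZ; apply: CkC_sum => s _; apply: CkC_mul; first exact: CkC_cst.
by apply: CkC_prod => i _; exact: CZ.
Qed.

Lemma CkM_adj n (Z : X -> 'M[C]_n) : CkM Z -> CkM (fun x => \adj (Z x)).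
Proof.
move=> CZ i j; apply: (@CkC_ext (fun x => cofactor (Z x) j i)) => [x _|].
  by rewrite mxE.
apply: CkC_mul; first exact: CkC_cst.
apply: CkM_det => a b.
by apply: CkC_ext (CZ (lift j a) (lift i b)) => x _; rewrite !mxE.
Qed.

Lemma CkM_inv n (Z : X -> 'M[C]_n) : (forall x, A x -> Z x \in unitmx) -> CkM Z ->
  CkM (fun x => invmx (Z x)).
Proof.
move=> uZ CZ i j.
have d0 x : A x -> \det (Z x) != 0 by move=> /uZ; rewrite unitmxE unitfE.
have := CkM_scale (CkC_inv d0 (CkM_det CZ)) (CkM_adj CZ).
by move=> /(_ i j); apply: CkC_ext => x Ax; rewrite /invmx uZ.
Qed.

Lemma CkM_of_cmx n (Z : X -> 'M[C]_n) : CkM Z -> Ck k A (fun x => of_cmx (Z x)).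
Proof.
move=> CZ; apply: Ck_pair => //; apply: Ck_mx => // i j; have [Zr Zi] := CZ i j.
  by apply: Ck_ext Zr => // x _; rewrite mxE.
by apply: Ck_ext Zi => // x _; rewrite mxE.
Qed.

Lemma CkM_cmx n (F : X -> 'M[R]_n * 'M[R]_n) : Ck k A F -> CkM (fun x => cmx (F x)).
Proof.
move=> CF i j; split.
  have cf : continuous (fst : 'M[R]_n * 'M[R]_n -> 'M[R]_n) by move=> ?; exact: cvg_fst.
  have lf : linear (fst : 'M[R]_n * 'M[R]_n -> 'M[R]_n) by [].
  by apply: Ck_ext (Ck_entry i j oA (Ck_lin_comp lf cf oA CF)) => // x _; rewrite mxE.
have cf : continuous (snd : 'M[R]_n * 'M[R]_n -> 'M[R]_n) by move=> ?; exact: cvg_snd.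
have lf : linear (snd : 'M[R]_n * 'M[R]_n -> 'M[R]_n) by [].
by apply: Ck_ext (Ck_entry i j oA (Ck_lin_comp lf cf oA CF)) => // x _; rewrite mxE.
Qed.

(** Reading real matrices as complex ones lets the results on products, determinants and adjugates
    serve both groups. *)
Lemma CkM_real m n (F : X -> 'M[R]_(m, n)) :
  Ck k A F <-> CkM (fun x => map_mx (real_complex R) (F x)).
Proof.
split=> [CF i j|CF].
  split; first by apply: Ck_ext (Ck_entry i j oA CF) => // x _; rewrite mxE.
  by apply: Ck_ext (@Ck_cst R X R k A (0 : R)) => // x _; rewrite mxE.
apply: Ck_mx => // i j; have [Cr _] := CF i j.
by apply: Ck_ext Cr => // x _; rewrite mxE.
Qed.

End ComplexCk.

(** * Derivatives at 0 of complex matrix curves *)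

Section ComplexDerivative.
Context {R : realType}.
Local Notation C := R[i].
Implicit Types f g : R -> C.

Definition cderiv f (l : C) :=
  is_derive (0 : R) (1 : R) (fun t => complex.Re (f t)) (complex.Re l) /\
  is_derive (0 : R) (1 : R) (fun t => complex.Im (f t)) (complex.Im l).

Lemma cderiv_near f g l : (\forall t \near 0, f t = g t) -> cderiv f l -> cderiv g l.
Proof.
by move=> fg [dr di]; split; [apply: near_eq_is_derive dr|apply: near_eq_is_derive di];
  apply: filterS fg => t ->.
Qed.

Lemma cderiv_ext f g l : (forall t, f t = g t) -> cderiv f l -> cderiv g l.
Proof. by move=> fg; apply: cderiv_near; near=> t; exact: fg. Unshelve. all: by end_near. Qed.

Lemma cderiv_uniq f l l' : cderiv f l -> cderiv f l' -> l = l'.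
Proof. by move=> [[_ r] [_ i]] [[_ r'] [_ i']]; apply: complex_ext; rewrite -?r -?i. Qed.

Lemma cderiv_cst (a : C) : cderiv (fun=> a) 0.
Proof. by split; exact: is_derive_cst. Qed.

Lemma cderiv_add f g l l' : cderiv f l -> cderiv g l' -> cderiv (fun t => f t + g t) (l + l').
Proof.
move=> [fr fi] [gr gi]; split; rewrite ?ReD ?ImD.
  rewrite (_ : (fun t => _) = (fun t => complex.Re (f t)) + (fun t => complex.Re (g t))).
    exact: is_deriveD.
  by apply/funext => t; rewrite ReD.
rewrite (_ : (fun t => _) = (fun t => complex.Im (f t)) + (fun t => complex.Im (g t))).
  exact: is_deriveD.
by apply/funext => t; rewrite ImD.
Qed.

Lemma cderiv_mul f g l l' : cderiv f l -> cderiv g l' ->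
  cderiv (fun t => f t * g t) (l * g 0 + f 0 * l').
Proof.
move=> [fr fi] [gr gi].
split.
  rewrite (_ : (fun t => _) = (fun t => complex.Re (f t)) * (fun t => complex.Re (g t)) -
    (fun t => complex.Im (f t)) * (fun t => complex.Im (g t))); last first.
    by apply/funext => t; rewrite ReM.
  apply: is_derive_eq; rewrite ReD !ReM -![_ *: _]/(_ * _); ring.
rewrite (_ : (fun t => _) = (fun t => complex.Re (f t)) * (fun t => complex.Im (g t)) +
  (fun t => complex.Im (f t)) * (fun t => complex.Re (g t))); last first.
  by apply/funext => t; rewrite ImM.
apply: is_derive_eq; rewrite ImD !ImM -![_ *: _]/(_ * _); ring.
Qed.

Lemma cderiv_conj f l : cderiv f l -> cderiv (fun t => (f t)^*) (l^*).
Proof.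
move=> [fr fi]; split; rewrite ?Re_conj ?Im_conj.
  by rewrite (_ : (fun t => _) = (fun t => complex.Re (f t))) //; apply/funext => t; rewrite Re_conj.
rewrite (_ : (fun t => _) = - (fun t => complex.Im (f t))); first exact: is_deriveN.
by apply/funext => t; rewrite Im_conj.
Qed.

Lemma cderiv_id (a : C) : cderiv (fun t => (t%:C)%C * a) a.
Proof.
split.
  rewrite (_ : (fun t => _) = complex.Re a *: id); last first.
    by apply/funext => t; rewrite ReM /= mul0r subr0 mulrC.
  by apply: is_derive_eq; rewrite -[LHS]/(_ * _) mulr1.
rewrite (_ : (fun t => _) = complex.Im a *: id); last first.
  by apply/funext => t; rewrite ImM /= mul0r addr0 mulrC.
by apply: is_derive_eq; rewrite -[LHS]/(_ * _) mulr1.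
Qed.

Lemma cderiv_sum (I : Type) (r : seq I) (P : pred I) (f : I -> R -> C) (l : I -> C) :
  (forall i, P i -> cderiv (f i) (l i)) ->
  cderiv (fun t => \sum_(i <- r | P i) f i t) (\sum_(i <- r | P i) l i).
Proof.
move=> df; elim: r => [|i r IH].
  rewrite big_nil; apply: cderiv_ext (cderiv_cst 0) => t; by rewrite big_nil.
rewrite big_cons; case Pi : (P i).
  by apply: cderiv_ext (cderiv_add (df _ Pi) IH) => t; rewrite big_cons Pi.
by apply: cderiv_ext IH => t; rewrite big_cons Pi.
Qed.

Lemma cderiv_exists (A : set R) f : A 0 -> CkC 1 A f -> exists l, cderiv f l.
Proof.
move=> A0 [[dr _] [di _]].
exists (Complex (derive1 (fun t => complex.Re (f t)) 0) (derive1 (fun t => complex.Im (f t)) 0)).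
by rewrite /cderiv /= !derive1E; split; apply: DeriveDef => //; apply: diff_derivable;
  [exact: dr|exact: di].
Qed.

Lemma cderiv_prod1 (I : Type) (r : seq I) (f : I -> R -> C) (l : I -> C) :
  (forall i, f i 0 = 1) -> (forall i, cderiv (f i) (l i)) ->
  cderiv (fun t => \prod_(i <- r) f i t) (\sum_(i <- r) l i).
Proof.
move=> f1 df; elim: r => [|i r IH].
  by rewrite big_nil; apply: cderiv_ext (cderiv_cst 1) => t; rewrite big_nil.
rewrite big_cons; have := cderiv_mul (df i) IH.
rewrite f1 mul1r (_ : \prod_(j <- r) f j 0 = 1) ?mulr1; last by rewrite big1.
by apply: cderiv_ext => t; rewrite big_cons.
Qed.

Lemma cderiv_bigprod_exists (I : Type) (r : seq I) (P : pred I) (f : I -> R -> C) (l : I -> C) :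
  (forall i, cderiv (f i) (l i)) -> exists l', cderiv (fun t => \prod_(i <- r | P i) f i t) l'.
Proof.
move=> df; elim: r => [|i r [l' IH]].
  by exists 0; apply: cderiv_ext (cderiv_cst 1) => t; rewrite big_nil.
case Pi : (P i); last by exists l'; apply: cderiv_ext IH => t; rewrite big_cons Pi.
by eexists; apply: cderiv_ext (cderiv_mul (df i) IH) => t; rewrite big_cons Pi.
Qed.

Lemma cderiv_prod0 (I : finType) (a b : I) (f : I -> R -> C) (l : I -> C) :
  a != b -> f a 0 = 0 -> f b 0 = 0 -> (forall i, cderiv (f i) (l i)) ->
  cderiv (fun t => \prod_i f i t) 0.
Proof.
move=> ab fa fb df.
have [l' dP] := cderiv_bigprod_exists (index_enum I) (fun i => (i != a) && (i != b)) df.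
have := cderiv_mul (df a) (cderiv_mul (df b) dP).
rewrite fa fb !mul0r !mulr0 addr0; apply: cderiv_ext => t.
by rewrite [RHS](bigD1 a) //= [in RHS](bigD1 b) //= eq_sym.
Qed.

Definition mderiv m n (Z : R -> 'M[C]_(m, n)) (Z' : 'M[C]_(m, n)) :=
  forall i j, cderiv (fun t => Z t i j) (Z' i j).

(** In the Leibniz expansion the identity permutation contributes the trace. Any other permutation
    moves some a and also its image s a, so its product has two factors vanishing at 0 and therefore
    zero derivative. *)
Lemma mderiv_det n (Z : R -> 'M[C]_n) Z' : Z 0 = 1%:M -> mderiv Z Z' ->
  cderiv (fun t => \det (Z t)) (\tr Z').
Proof.
move=> Z0 dZ; rewrite /mxtrace.
have -> : \sum_i Z' i i = \sum_(s : 'S_n) if s == 1%g then \sum_i Z' i i else 0.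
  by rewrite [RHS](bigD1 1%g) //= [X in _ = _ + X]big1 ?addr0 ?eqxx // => s /negbTE ->.
apply: cderiv_sum => s _.
have -> : (if s == 1%g then \sum_i Z' i i else 0) =
    0 * (\prod_i Z 0 i (s i)) + (-1) ^+ s * (if s == 1%g then \sum_i Z' i i else 0).
  by case: eqP => [->|_]; rewrite ?odd_perm1 mul0r ?mulr0 add0r // expr0 mul1r.
apply: cderiv_mul; first exact: cderiv_cst.
case: eqP => [->|/eqP s1].
  rewrite (eq_bigr (fun i => Z' i ((1 : 'S_n)%g i))) => [|i _]; last by rewrite perm1.
  by apply: cderiv_prod1 => i; [rewrite perm1 Z0 mxE eqxx|exact: dZ].
have [a sa] : exists a, s a != a.
  apply/existsP; apply: contraNT s1; rewrite negb_exists => /forallP sid.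
  by apply/eqP/permP => a; rewrite perm1; apply/eqP/negPn.
apply: (@cderiv_prod0 _ a (s a) _ (fun i => Z' i (s i))); first by rewrite eq_sym.
- by rewrite Z0 mxE eq_sym (negbTE sa).
- by rewrite Z0 mxE eq_sym (inj_eq perm_inj) (negbTE sa).
- by move=> i; exact: dZ.
Qed.

Lemma mderiv_near m n (Z Y : R -> 'M[C]_(m, n)) Z' :
  (\forall t \near 0, Z t = Y t) -> mderiv Z Z' -> mderiv Y Z'.
Proof. by move=> ZY dZ i j; apply: cderiv_near (dZ i j); apply: filterS ZY => t ->. Qed.

Lemma mderiv_uniq m n (Z : R -> 'M[C]_(m, n)) Z' Z'' : mderiv Z Z' -> mderiv Z Z'' -> Z' = Z''.
Proof. by move=> dZ dY; apply/matrixP => i j; exact: cderiv_uniq (dZ i j) (dY i j). Qed.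

Lemma mderiv_cst m n (Z : 'M[C]_(m, n)) : mderiv (fun=> Z) 0.
Proof. by move=> i j; rewrite mxE; exact: cderiv_cst. Qed.

Lemma mderiv_add m n (Z Y : R -> 'M[C]_(m, n)) Z' Y' :
  mderiv Z Z' -> mderiv Y Y' -> mderiv (fun t => Z t + Y t) (Z' + Y').
Proof.
move=> dZ dY i j; rewrite mxE; apply: cderiv_ext (cderiv_add (dZ i j) (dY i j)) => t.
by rewrite mxE.
Qed.

Lemma mderiv_mul m n p (Z : R -> 'M[C]_(m, n)) (Y : R -> 'M[C]_(n, p)) Z' Y' :
  mderiv Z Z' -> mderiv Y Y' -> mderiv (fun t => Z t *m Y t) (Z' *m Y 0 + Z 0 *m Y').
Proof.
move=> dZ dY i j; rewrite !mxE -big_split /=.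
apply: cderiv_ext (cderiv_sum _ (fun l _ => cderiv_mul (dZ i l) (dY l j))) => t.
by rewrite mxE.
Qed.

Lemma mderiv_scale m n f (Z : R -> 'M[C]_(m, n)) l Z' :
  cderiv f l -> mderiv Z Z' -> mderiv (fun t => f t *: Z t) (l *: Z 0 + f 0 *: Z').
Proof.
move=> df dZ i j; rewrite !mxE; apply: cderiv_ext (cderiv_mul df (dZ i j)) => t.
by rewrite mxE.
Qed.

Lemma mderiv_conj m n (Z : R -> 'M[C]_(m, n)) Z' : mderiv Z Z' ->
  mderiv (fun t => (map_mx Num.conj (Z t)^T)) (map_mx Num.conj Z'^T).
Proof.
by move=> dZ i j; rewrite !mxE; apply: cderiv_ext (cderiv_conj (dZ j i)) => t; rewrite !mxE.
Qed.

Lemma mderiv_line m n (Z : 'M[C]_(m, n)) : mderiv (fun t => (t%:C)%C *: Z) Z.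
Proof. by move=> i j; apply: cderiv_ext (cderiv_id _) => t; rewrite mxE. Qed.

Lemma mderiv_real_derive1 m n (F : R -> 'M[R]_(m, n)) : differentiable F 0 ->
  mderiv (fun t => map_mx (real_complex R) (F t)) (map_mx (real_complex R) (derive1 F 0)).
Proof.
move=> dF i j.
have lin : linear (fun M : 'M[R]_(m, n) => M i j) by move=> a M N; rewrite !mxE.
have [d D] := lin_comp_diff lin (@coord_continuous _ _ _ i j) dF.
split; rewrite mxE /=.
  rewrite (_ : (fun t => _) = (fun M : 'M[R]_(m, n) => M i j) \o F); last first.
    by apply/funext => t; rewrite mxE.
  by rewrite derive1E -D; apply: DeriveDef => //; exact: diff_derivable.
rewrite (_ : (fun t => _) = cst 0); first exact: is_derive_cst.
by apply/funext => t; rewrite mxE.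
Qed.

Lemma mderiv_cmx_derive1 n (F : R -> 'M[R]_n * 'M[R]_n) :
  differentiable F 0 -> mderiv (fun t => cmx (F t)) (cmx (derive1 F 0)).
Proof.
move=> dF i j.
have l1 : linear (fun M : 'M[R]_n * 'M[R]_n => M.1 i j) by move=> a M N; rewrite !mxE.
have l2 : linear (fun M : 'M[R]_n * 'M[R]_n => M.2 i j) by move=> a M N; rewrite !mxE.
have c1 : continuous (fun M : 'M[R]_n * 'M[R]_n => M.1 i j).
  by apply: lin_continuous_pair l1 => ? ?; exact: lin_continuous_mx.
have c2 : continuous (fun M : 'M[R]_n * 'M[R]_n => M.2 i j).
  by apply: lin_continuous_pair l2 => ? ?; exact: lin_continuous_mx.
have [d1 D1] := lin_comp_diff l1 c1 dF; have [d2 D2] := lin_comp_diff l2 c2 dF.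
rewrite /cderiv mxE /= derive1E -D1 -D2; split.
  rewrite (_ : (fun t => _) = (fun M : 'M[R]_n * 'M[R]_n => M.1 i j) \o F); last first.
    by apply/funext => t; rewrite mxE.
  by apply: DeriveDef => //; exact: diff_derivable.
rewrite (_ : (fun t => _) = (fun M : 'M[R]_n * 'M[R]_n => M.2 i j) \o F); last first.
  by apply/funext => t; rewrite mxE.
by apply: DeriveDef => //; exact: diff_derivable.
Qed.

End ComplexDerivative.

(** * The Lie algebra of the special linear group *)

Section TangentSL.
Context {R : realType}.
Local Notation C := R[i].

Lemma CkC_real k (A : set R) : CkC k A (real_complex R).
Proof.
split; first by apply: (@Ck_lin R R R id) => // x; exact: cvg_id.
exact: (@Ck_cst R R R k A 0).
Qed.

Lemma ratio_cancel (F : fieldType) (a b : F) : a != 0 -> b != 0 -> a^-1 * b * (a / b) = 1.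
Proof. by move=> a0 b0; field; rewrite a0 b0. Qed.

Lemma ratio_cancel2 (F : fieldType) (a b : F) : a != 0 -> b != 0 -> b / a * (a / b) = 1.
Proof. by move=> a0 b0; field; rewrite a0 b0. Qed.

Lemma mulmx_swap (F : fieldType) n (A B E D : 'M[F]_n) : E *m D = D *m E ->
  A *m E *m (D *m B) = A *m D *m (E *m B).
Proof. by move=> ED; rewrite !mulmxA -(mulmxA A E) ED mulmxA. Qed.

Lemma invmx_comm (F : fieldType) n (A B : 'M[F]_n) : A \in unitmx ->
  A *m B = B *m A -> invmx A *m B = B *m invmx A.
Proof. by move=> uA AB; rewrite -[LHS](mulmxK uA) -(mulmxA (invmx A) B A) -AB mulKmx. Qed.

Lemma affine_comm (F : fieldType) n (X : 'M[F]_n) (a b : F) :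
  (1%:M + a *: X) *m (1%:M + b *: X) = (1%:M + b *: X) *m (1%:M + a *: X).
Proof.
rewrite ?(mulmxDl, mulmxDr, mul1mx, mulmx1) -?scalemxAl -?scalemxAr.
by mxring.
Qed.

Lemma reflectionM (F : fieldType) n (e : 'M[F]_n) (s r : F) : e *m e = e ->
  (1%:M - e + s *: e) *m (1%:M - e + r *: e) = 1%:M - e + (s * r) *: e.
Proof.
move=> ee; rewrite ?(mulmxDl, mulmxDr, mulmxN, mulNmx, mul1mx, mulmx1) -?scalemxAl -?scalemxAr ee.
by mxring.
Qed.

Lemma det_reflection (F : fieldType) n k (hn : n = k.*2.+1) (s : F) :
  \det (1%:M - mid k + s *: mid k : 'M[F]_n) = s.
Proof.
have -> : 1%:M - mid k + s *: mid k = dgm (fun a : 'I_n => if a == k :> nat then s else 1).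
  apply/matrixP => a b; rewrite addmxE addmxE oppmxE scalemxE !dgmE mxE.
  by case: (a == b); case: (a == k :> nat); rewrite ?mulr1n ?mulr0n; ring.
rewrite det_diag (bigD1 (mid_ord hn)) //= mxE eqxx big1 ?mulr1 // => a.
by rewrite mxE (mid_ordP hn) => /negbTE ->.
Qed.

Lemma map_mid (n k : nat) : map_mx (real_complex R) (mid k : 'M[R]_n) = mid k.
Proof. by apply/matrixP => a b; rewrite mxE !dgmE rmorphMn rmorph_nat. Qed.

Lemma open_det_neq0 n (Z : R -> 'M[C]_n) : (forall k, CkM k setT Z) ->
  open [set t | \det (Z t) != 0].
Proof.
move=> CZ; have [Cr Ci] := CkM_det (openT : open (@setT R)) (CZ 0%N).
have -> : [set t | \det (Z t) != 0] =
    (fun t => complex.Re (\det (Z t))) @^-1` [set x | x != 0] `|`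
    (fun t => complex.Im (\det (Z t))) @^-1` [set x | x != 0].
  apply/seteqP; split=> t /=; rewrite eq_complex /= negb_and.
    by move=> /orP[]; [left|right].
  by move=> [] h; rewrite h ?orbT.
apply: openU; apply: open_comp; try exact: open_neq.
  by move=> x _; exact: Cr.
by move=> x _; exact: Ci.
Qed.

Lemma tangent_SL1 n k (hn : n = k.*2.+1) (v : 'M[R]_n) :
  tangent (SL R n) 1%:M v <-> \tr v = 0.
Proof.
pose toC := map_mx (real_complex R) : 'M[R]_n -> 'M[C]_n.
have oT : open (@setT R) by exact: openT.
split=> [[c cc]|tv].
  have [dc cG] := curve_at_differentiable cc; have [c0 cv _] := cc.
  have dZ : mderiv (fun t => toC (c t)) (toC v).
    by rewrite -cv; exact: mderiv_real_derive1.
  have Z0 : toC (c 0) = 1%:M by rewrite c0 /toC map_mx1.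
  have ddet : cderiv (fun t => \det (toC (c t))) 0.
    apply: cderiv_near (cderiv_cst 1); apply: filterS cG => t; rewrite /SL /= /toC det_map_mx => ->.
    by rewrite rmorph1.
  have := cderiv_uniq (mderiv_det Z0 dZ) ddet.
  by rewrite /toC trace_map_mx => -[].
pose M (t : R) : 'M[R]_n := 1%:M + t *: v.
pose N t : 'M[R]_n := 1%:M - mid k + (\det (M t))^-1 *: mid k.
have ME t : toC (M t) = 1%:M + (t%:C)%C *: toC v.
  by rewrite /toC map_mxD map_mx1 map_mxZ.
have CM j : CkM j setT (fun t => toC (M t)).
  apply: (CkM_ext oT) => [t _|]; first by rewrite ME.
  apply: (CkM_add oT); first exact: CkM_cst.
  by apply: (CkM_scale oT); [exact: CkC_real|exact: CkM_cst].
pose U := [set t | \det (toC (M t)) != 0].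
have oU : open U by exact: open_det_neq0.
have dME t : \det (toC (M t)) = (\det (M t))%:C%C by rewrite /toC det_map_mx.
have U0 : U 0 by rewrite /U /= /toC /M scale0r addr0 map_mx1 det1 oner_neq0.
have CMU j : CkM j U (fun t => toC (M t)).
  apply: (CkM_ext oU) => [t _|]; first by rewrite ME.
  apply: (CkM_add oU); first exact: CkM_cst.
  by apply: (CkM_scale oU); [exact: CkC_real|exact: CkM_cst].
have CN j : CkM j U (fun t => toC (N t)).
  apply: (@CkM_ext _ _ _ _ oU _ _ (fun t => 1%:M - mid k + (\det (toC (M t)))^-1 *: mid k)) => //.
    by move=> t _; rewrite dME /toC map_mxD map_mxB map_mx1 map_mxZ !map_mid fmorphV.
  apply: (CkM_add oU); first exact: CkM_cst.
  apply: (CkM_scale oU); last exact: CkM_cst.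
  by apply: (CkC_inv oU); [|exact: CkM_det].
pose c t := M t *m N t.
have Cc j : Ck j U c.
  apply/(CkM_real _ oU); apply: (CkM_ext oU) (CkM_mul oU (CMU j) (CN j)) => t _.
  by rewrite /toC map_mxM.
have cU t : U t -> SL R n (c t).
  rewrite /U /= dME => dt; rewrite /SL /= det_mulmx (det_reflection hn) mulfV //.
  by apply: contraNneq dt => ->; rewrite rmorph0.
have c0 : c 0 = 1%:M.
  by rewrite /c /N /M scale0r addr0 det1 invr1 scale1r subrK mulmx1.
exists c; split=> //; last by exists U.
have dc : differentiable c 0 by have [d _] := Cc 1%N; exact: d.
have dZ := mderiv_real_derive1 dc.
have dM : mderiv (fun t => toC (M t)) (toC v).
  rewrite -[X in mderiv _ X]add0r.
  have := mderiv_add (mderiv_cst 1%:M) (mderiv_line (toC v)).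
  by apply: mderiv_near; near=> t; rewrite ME.
have ddet : cderiv (fun t => \det (toC (M t))) 0.
  have := mderiv_det _ dM; rewrite trace_map_mx tv rmorph0; apply.
  by rewrite ME scale0r addr0.
(* The velocity of [c] is obtained by undoing the correction: c(t) times the scaling by det M(t) is
   M(t), and both sides are differentiated, which avoids differentiating an inverse. *)
have dR := mderiv_mul dZ (mderiv_add (mderiv_cst (1%:M - mid k))
  (mderiv_scale ddet (mderiv_cst (mid k)))).
have dL : mderiv (fun t => toC (M t)) (toC (derive1 c 0)).
  move: dR; rewrite -/toC c0 dME /M scale0r addr0 det1 rmorph1 scale1r subrK mulmx1.
  rewrite scale0r scaler0 !addr0 mulmx0 addr0; apply: mderiv_near.
  have : nbhs 0 U by exact: open_nbhs_nbhs.
  apply: filterS => t Ut.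
  have -> : 1%:M - mid k + \det (toC (M t)) *: mid k =
      toC (1%:M - mid k + \det (M t) *: mid k).
    by rewrite dME /toC map_mxD map_mxB map_mx1 map_mxZ !map_mid.
  rewrite /toC -map_mxM; congr map_mx; rewrite /c -mulmxA -[RHS]mulmx1; congr (_ *m _).
  have dt : \det (M t) != 0.
    by move: Ut; rewrite /U /= dME; apply: contraNneq => ->; rewrite rmorph0.
  by rewrite /N (reflectionM _ _ (mul_mid_mid hn)) mulVf // scale1r subrK.
have := mderiv_uniq dL dM => /matrixP E; apply/matrixP => i j.
by have := E i j; rewrite !mxE => -[].
Unshelve. all: by end_near. Qed.

End TangentSL.

(** * The group SU(H) and its Lie algebra *)

Section TangentSU.
Context {R : realType} {n : nat}.
Local Notation C := R[i].
Local Open Scope sesquilinear_scope.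
Implicit Types (A B : 'M[R]_n * 'M[R]_n) (Z : 'M[C]_n).

Lemma of_cmxK Z : cmx (of_cmx Z) = Z.
Proof. by apply/matrixP => i j; rewrite !mxE; case: (Z i j). Qed.

Lemma cmxK A : of_cmx (cmx A) = A.
Proof. by case: A => A B; congr (_, _); apply/matrixP => i j; rewrite !mxE. Qed.

Lemma cmx_inj A B : cmx A = cmx B -> A = B.
Proof. by move=> AB; rewrite -[A]cmxK AB cmxK. Qed.

Lemma cmx_mul A B : cmx (mul_cmx A B) = cmx A *m cmx B.
Proof. exact: of_cmxK. Qed.

Lemma cmxP (a : R) A B : cmx (a *: A + B) = a%:C%C *: cmx A + cmx B.
Proof.
apply/matrixP => i j; rewrite !mxE; apply: complex_ext; rewrite ?ReD ?ImD ?ReM ?ImM /=;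
  by rewrite ?mxE mul0r ?subr0 ?addr0.
Qed.

Lemma of_cmxP (a : R) Z Y : of_cmx (a%:C%C *: Z + Y) = a *: of_cmx Z + of_cmx Y.
Proof. by apply: cmx_inj; rewrite cmxP !of_cmxK. Qed.

Lemma ctmxM m p q (Z : 'M[C]_(m, p)) (Y : 'M[C]_(p, q)) : (Z *m Y)^t* = Y^t* *m Z^t*.
Proof. by rewrite trmx_mul map_mxM. Qed.

Lemma ctmxD m p (Z Y : 'M[C]_(m, p)) : (Z + Y)^t* = Z^t* + Y^t*.
Proof. by rewrite linearD map_mxD. Qed.

Lemma ctmxZ m p a (Z : 'M[C]_(m, p)) : (a *: Z)^t* = a^* *: Z^t*.
Proof. by rewrite linearZ map_mxZ. Qed.

Lemma ctmxN m p (Z : 'M[C]_(m, p)) : (- Z)^t* = - Z^t*.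
Proof. by rewrite linearN map_mxN. Qed.

Lemma ctmx1 m : (1%:M : 'M[C]_m)^t* = 1%:M.
Proof. by rewrite trmx1 map_mx1. Qed.

Lemma det_ctmx Z : \det (Z^t*) = (\det Z)^*.
Proof. by rewrite det_map_mx det_tr. Qed.

Lemma conj_real (a : R) : ((a%:C)%C : C)^* = a%:C%C.
Proof. by apply: complex_ext; rewrite ?Re_conj ?Im_conj /= ?oppr0. Qed.

Context (H : 'M[C]_n) (Hu : H \in unitmx) (Hh : H^t* = H).
Context (e : 'M[C]_n) (ee : e *m e = e) (eH : e^t* *m H = H *m e).
Hypothesis det_e : forall s, \det (1%:M - e + s *: e) = s.

Lemma SU_mul A B : SU H A -> SU H B -> SU H (mul_cmx A B).
Proof.
move=> [dA HA] [dB HB]; split; rewrite cmx_mul ?det_mulmx ?dA ?dB ?mulr1 //.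
have -> : (cmx A *m cmx B)^t* *m H *m (cmx A *m cmx B) =
    (cmx B)^t* *m ((cmx A)^t* *m H *m cmx A) *m cmx B by rewrite ctmxM !mulmxA.
by rewrite HA HB.
Qed.

(** The relation A^* H A = H makes this the inverse on the group; being R-linear in A, it is smooth
    on the whole ambient space. *)
Definition inv_SU A := of_cmx (invmx H *m (cmx A)^t* *m H).

Lemma SU_mulVx A : SU H A -> mul_cmx (inv_SU A) A = of_cmx 1%:M.
Proof.
move=> [_ HA]; apply: cmx_inj; rewrite cmx_mul !of_cmxK -!mulmxA.
by rewrite (mulmxA _ H) HA mulVmx.
Qed.

Lemma SU_mulxV A : SU H A -> mul_cmx A (inv_SU A) = of_cmx 1%:M.
Proof.
move=> /SU_mulVx /(congr1 (@cmx R n)); rewrite cmx_mul of_cmxK => E.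
by apply: cmx_inj; rewrite cmx_mul (mulmx1C E) of_cmxK.
Qed.

Lemma SU_inv A : SU H A -> SU H (inv_SU A).
Proof.
move=> GA; have := SU_mulVx GA; have := SU_mulxV GA; have [dA HA] := GA.
move=> /(congr1 (@cmx R n)); rewrite cmx_mul of_cmxK => AV.
move=> /(congr1 (@cmx R n)); rewrite cmx_mul of_cmxK => VA.
split; first by have := congr1 determinant VA; rewrite det_mulmx dA mulr1 det1.
set Y := cmx (inv_SU A) in AV VA *.
by rewrite -[in LHS]HA !mulmxA -ctmxM AV ctmx1 mul1mx -mulmxA AV mulmx1.
Qed.

Lemma inv_SU_linear : linear inv_SU.
Proof.
move=> a A B; rewrite /inv_SU cmxP ctmxD ctmxZ conj_real mulmxDr mulmxDl -of_cmxP.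
by rewrite -scalemxAr -scalemxAl.
Qed.

(* The Cayley transform [(1 - t X)^-1 (1 + t X)] is unitary with determinant
   [conj d / d]; rescaling by [d / conj d] along the projector [e] brings it
   back into SU without changing its derivative [2 X]. *)
Lemma SU_tangent1 (v : 'M[R]_n * 'M[R]_n) :
  tangent (SU H) (of_cmx 1%:M) v <->
  (cmx v)^t* *m H + H *m cmx v = 0 /\ \tr (cmx v) = 0.
Proof.
split=> [[c cc]|[vH tv]].
  have [dc cG] := curve_at_differentiable cc; have [c0 cv _] := cc.
  have dZ := mderiv_cmx_derive1 dc; rewrite cv in dZ.
  have Z0 : cmx (c 0) = 1%:M by rewrite c0 of_cmxK.
  split.
    have dH := mderiv_mul (mderiv_mul (mderiv_conj dZ) (mderiv_cst H)) dZ.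
    have dH0 : mderiv (fun t => (cmx (c t))^t* *m H *m cmx (c t)) 0.
      by apply: mderiv_near (mderiv_cst H); apply: filterS cG => t [_ ->].
    have := mderiv_uniq dH dH0; rewrite Z0.
    by rewrite -/((1%:M : 'M[C]_n)^t*) ctmx1 !mulmx1 !mul1mx addr0.
  have ddet : cderiv (fun t => \det (cmx (c t))) 0.
    by apply: cderiv_near (cderiv_cst 1); apply: filterS cG => t [-> _].
  exact: cderiv_uniq (mderiv_det Z0 dZ) ddet.
pose X := 2^-1 *: cmx v.
have XH : X^t* *m H = - (H *m X).
  apply/eqP; rewrite -addr_eq0; apply/eqP.
  have -> : X = ((2^-1 : R)%:C)%C *: cmx v by rewrite fmorphV rmorph_nat.
  by rewrite ctmxZ conj_real -scalemxAl -scalemxAr -scalerDr vH scaler0.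
have trX : \tr X = 0 by rewrite linearZ /= tv mulr0.
have vX : cmx v = X + X.
  by rewrite -mulr2n -scaler_nat scalerA mulfV ?scale1r // pnatr_eq0.
clearbody X.
pose M (s : R) : 'M[C]_n := 1%:M + (s%:C)%C *: X.
have CM k (U : set R) (f : R -> R) : open U -> Ck k U f -> CkM k U (fun t => M (f t)).
  move=> oU Cf; apply: (CkM_add oU); first exact: CkM_cst.
  apply: (CkM_scale oU); last exact: CkM_cst.
  by split=> //; exact: (@Ck_cst R R R k U 0).
pose d t := \det (M (- t)).
have oT : open (@setT R) by exact: openT.
have Copp k U : Ck k U (fun t : R => - t).
  by apply: (@Ck_lin R R R (fun t => - t)) => [a x y|x];
    [rewrite opprD scalerN|exact: opp_continuous].
pose U := [set t | d t != 0].
have oU : open U by apply: open_det_neq0 => k; exact: CM.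
have M0 : M 0 = 1%:M by rewrite /M scale0r addr0.
have d0 : d 0 = 1 by rewrite /d oppr0 M0 det1.
have U0 : U 0 by rewrite /U /= d0 oner_neq0.
have MH s : (M s)^t* *m H = H *m M (- s).
  rewrite /M ctmxD ctmx1 ctmxZ conj_real mulmxDl mul1mx -scalemxAl XH.
  have -> : (- s)%:C%C = - s%:C%C :> C by rewrite rmorphN.
  by rewrite mulmxDr mulmx1 -scalemxAr scaleNr scalerN.
have MC s r : M s *m M r = M r *m M s.
  exact: affine_comm.
have dM t : \det (M t) = (d t)^*.
  have detH : \det H != 0 by rewrite -unitfE -unitmxE.
  apply: (mulfI detH); have := congr1 determinant (MH (- t)).
  by rewrite opprK !det_mulmx det_ctmx => <-; rewrite mulrC.
pose om t : C := d t / (d t)^*.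
pose F t : 'M[C]_n := 1%:M - e + om t *: e.
pose Z t := invmx (M (- t)) *m M t *m F t.
have conjd t : U t -> (d t)^* != 0 by rewrite /U /= conjC_eq0.
have Com k : CkC k U om.
  apply: (CkC_mul oU); first by apply: (CkM_det oU); exact: CM.
  apply: (CkC_inv oU) => [//|]; apply: (CkC_conj oU).
  by apply: (CkM_det oU); exact: CM.
have uM t : U t -> M (- t) \in unitmx by rewrite unitmxE unitfE.
have CZ k : CkM k U Z.
  apply: (CkM_mul oU).
    apply: (CkM_mul oU); last by apply: CM => //; apply: (@Ck_lin R R R id) => // x; exact: cvg_id.
    by apply: (CkM_inv oU) => //; exact: CM.
  apply: (CkM_add oU); first exact: CkM_cst.
  by apply: (CkM_scale oU) => //; exact: CkM_cst.
have ZU t : U t -> SU H (of_cmx (Z t)).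
  move=> Ut; have dt : d t != 0 by []; have dct := conjd _ Ut.
  split; rewrite of_cmxK.
    have -> : \det (Z t) = (\det (M (- t)))^-1 * \det (M t) * \det (F t).
      by rewrite -det_inv -!det_mulmx.
    have -> : \det (F t) = om t by exact: det_e.
    transitivity ((d t)^-1 * (d t)^* * om t); last exact: (ratio_cancel dt dct).
    by congr (_ * _ * _); exact: dM.
  have MVM : (invmx (M (- t)))^t* *m H *m M t = H.
    have := MH (- t); rewrite opprK -mulmxA => <-.
    by rewrite mulmxA -ctmxM mulmxV ?uM // ctmx1 mul1mx.
  have MVC : invmx (M (- t)) *m M t = M t *m invmx (M (- t)).
    exact: invmx_comm (uM _ Ut) (MC _ _).
  have FH : (F t)^t* *m H *m F t = H.
    have -> : (F t)^t* *m H = H *m (1%:M - e + (om t)^* *: e).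
      have -> : (F t)^t* = 1%:M - e^t* + (om t)^* *: e^t*.
        by rewrite ctmxD ctmxD ctmxZ ctmxN ctmx1.
      by rewrite mulmxDl mulmxBl mul1mx -scalemxAl eH mulmxDr mulmxBr mulmx1 -scalemxAr.
    have omC : (om t)^* * om t = 1.
      have -> : (om t)^* = (d t)^* / d t.
        by rewrite /om rmorphM fmorphV; congr (_ * _^-1); exact: conjCK.
      exact: ratio_cancel2.
    by rewrite -mulmxA (reflectionM _ _ ee) omC scale1r subrK mulmx1.
  have -> : (Z t)^t* *m H *m Z t =
      (F t)^t* *m ((M t)^t* *m ((invmx (M (- t)))^t* *m H *m M t *m invmx (M (- t)))) *m F t.
    have ZE : Z t = M t *m invmx (M (- t)) *m F t by rewrite -MVC.
    have -> : (Z t)^t* = (F t)^t* *m ((M t)^t* *m (invmx (M (- t)))^t*).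
      by rewrite -!ctmxM.
    rewrite ZE; move: ((F t)^t*) ((M t)^t*) ((invmx _)^t*) => F1 M1 I1.
    by move: (F t) (M t) (invmx _) => F2 M2 I2; rewrite !mulmxA.
  by rewrite MVM (mulmxA _ H) MH mulmxK ?uM.
have om0 : om 0 = 1 by rewrite /om d0 conjC1 divr1.
have c0 : of_cmx (Z 0) = of_cmx 1%:M.
  congr of_cmx; rewrite /Z oppr0 M0 invmx1 !mul1mx /F om0.
  by rewrite scale1r subrK.
exists (fun t => of_cmx (Z t)); split=> //; last first.
  by exists U; split=> //; split=> // k; exact: CkM_of_cmx.
have dc : differentiable (fun t => of_cmx (Z t)) 0.
  by have [D _] := CkM_of_cmx oU (CZ 1%N); exact: D.
have := mderiv_cmx_derive1 dc; set Z' := cmx _ => dZ'.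
have dZ : mderiv Z Z'.
  by apply: mderiv_near dZ'; near=> t; rewrite of_cmxK.
suff : Z' = cmx v by move/cmx_inj.
have dM1 : mderiv M X.
  by rewrite -[X]add0r; exact: mderiv_add (mderiv_cst _) (mderiv_line _).
have dM2 : mderiv (fun t => M (- t)) (- X).
  rewrite -[- X]add0r.
  have := mderiv_add (mderiv_cst 1%:M) (mderiv_line (- X)).
  by apply: mderiv_near; near=> t; rewrite /M rmorphN /= scaleNr scalerN.
have dd : cderiv d 0.
  have M0' : (fun t => M (- t)) 0 = 1%:M by rewrite oppr0.
  by have := mderiv_det M0' dM2; rewrite linearN /= trX oppr0.
(* Smoothness gives the existence of a derivative l of [om]; its value comes from differentiating
   om(t) conj(d(t)) = d(t), where d has derivative tr(- X) = 0. *)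
have [l dom] := cderiv_exists U0 (Com 1%N).
have nU : \forall t \near 0, U t by exact: open_nbhs_nbhs.
have l0 : l = 0.
  have E : l * (d 0)^* + om 0 * 0^* = l.
    by rewrite d0 om0 conjC1 conjC0 mulr1 mulr0 addr0.
  have := cderiv_mul dom (cderiv_conj dd); rewrite E => D1.
  have D2 : cderiv (fun t => om t * (d t)^*) 0.
    apply: cderiv_near dd; apply: filterS nU => t Ut.
    by apply/esym; exact: divfK (conjd _ Ut) _.
  exact: cderiv_uniq D1 D2.
rewrite l0 in dom.
have dF : mderiv F 0.
  have := mderiv_add (mderiv_cst (1%:M - e)) (mderiv_scale dom (mderiv_cst e)).
  have E : (0 : 'M[C]_n) + (0 *: e + om 0 *: 0) = 0 by rewrite scale0r scaler0 !addr0.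
  by rewrite E.
have := mderiv_mul dM2 dZ; have := mderiv_mul dM1 dF.
have Z0 : Z 0 = 1%:M by rewrite -[Z 0]of_cmxK c0 of_cmxK.
have F0 : F 0 = 1%:M by rewrite /F om0 scale1r subrK.
have E1 : X *m F 0 + M 0 *m 0 = X by rewrite F0 mulmx1 mulmx0 addr0.
have E2 : - X *m Z 0 + M (- 0) *m Z' = - X + Z' by rewrite Z0 oppr0 M0 mulmx1 mul1mx.
rewrite E1 E2 => dR dL.
(* Same device for the curve: M(-t) Z(t) = M(t) F(t) is differentiated, giving - X + Z' = X. *)
have dR' : mderiv (fun t => M (- t) *m Z t) X.
  apply: mderiv_near dR; apply: filterS nU => t Ut.
  by rewrite /Z -mulmxA; apply/esym; exact: mulKVmx (uM _ Ut) _.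
by rewrite vX -[X in X + _](mderiv_uniq dL dR') addrAC addNr add0r.
Unshelve. all: by end_near. Qed.

End TangentSU.

(** * Pulling the operator back along a multiplicative map into matrices *)

Section Transfer.
Context {F : fieldType} {n k : nat} (hn : n = k.*2.+1) (two0 : (2 : F) != 0).
Context {V : zmodType} (mul : V -> V -> V) (phi : V -> 'M[F]_n).
Hypothesis phiB : forall x y, phi (x - y) = phi x - phi y.
Hypothesis phiM : forall x y, phi (mul x y) = phi x *m phi y.
Context (al be ga w : F) (w0 : w != 0) (S : V -> V).
Hypothesis phiS : forall x, phi (S x) = pencil k al be ga w (phi x).

Lemma transfer_sqr x : \tr (phi x) = 0 -> phi (S (S x)) = gen_sq al be ga *: phi x.
Proof. by move=> tx; rewrite !phiS (pencil_sqr hn) // tx scale0r subr0. Qed.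

Lemma transfer_nij x y :
  phi (mul (S x) (S y) - mul (S y) (S x)) + gen_sq al be ga *: phi (mul x y - mul y x)
  - phi (S (mul (S x) y - mul y (S x))) - phi (S (mul x (S y) - mul (S y) x)) = 0.
Proof.
rewrite -[RHS](pencil_integrable hn two0 al be ga w (phi x) (phi y)) /nij /comm.
rewrite !(phiS, phiB, phiM); move: (pencil _ _ _ _ _ (phi x)) (pencil _ _ _ _ _ (phi y)) => A B.
rewrite (pencilD k al be ga w (A *m phi y - phi y *m A)).
by move: (pencil _ _ _ _ _ _) (pencil _ _ _ _ _ _) => D E; rewrite opprD addrA.
Qed.

End Transfer.

(** * The structures on SL(n, R) *)

Section SpecialLinear.
Context {R : realType}.

Lemma SL_complex_product n k (hn : n = k.*2.+1) : exists P J,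
  [/\ complex_product_structure (SL R n) P J, left_invariant (SL R n) mulmx P
    & left_invariant (SL R n) mulmx J].
Proof.
pose L (v : 'M[R]_n) : 'M[R]_1 := (\tr v)%:M.
have linL : linear L by move=> a u v; rewrite /L linearP /= raddfD /= scale_scalar_mx.
have LP v : L v = 0 <-> \tr v = 0.
  split=> [/matrixP /(_ ord0 ord0)|tv]; first by rewrite !mxE eqxx mulr1n.
  by rewrite /L tv raddf0.
have [d [b basis]] := @ker_basis R 'M[R]_n 'M[R]_1 L linL.
(* At w = -1 the coefficients 1 + w and 1 + w^-1 vanish, and only the trace term of [corr]
   survives. *)
pose S al be ga : 'M[R]_n -> 'M[R]_n := pencil k al be ga (-1).
have linS al be ga : linear (S al be ga) by move=> a x y; rewrite /S [a *: x + y]addrC pencilP [RHS]addrC.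
have contS al be ga : continuous (S al be ga) by exact: lin_continuous_mx.
have two0 : (2 : R) != 0 by rewrite pnatr_eq0.
have w0 : (-1 : R) != 0 by rewrite oppr_eq0 oner_eq0.
have kerS al be ga x : L x = 0 -> L (S al be ga x) = 0.
  by move=> _; apply/LP; exact: (tr_pencil hn).
have sqr al be ga x : L x = 0 -> S al be ga (S al be ga x) = gen_sq al be ga *: x.
  by move=> /LP tx; rewrite /S (pencil_sqr hn) // tx scale0r subr0.
have nijS al be ga x y := @transfer_nij R n k hn two0 'M[R]_n mulmx id (fun _ _ => erefl) (fun _ _ => erefl)
  al be ga (-1) (S al be ga) (fun _ => erefl) x y.
have gP : gen_sq (1 : R) 0 0 = 1 by rewrite /gen_sq mulr0 addr0 expr1n.
have gJ : gen_sq (0 : R) 1 (-1) = -1 by rewrite /gen_sq expr0n /= add0r mul1r.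
have oT : open (@setT 'M[R]_n) by exact: openT.
(* [adjugate] is polynomial and is the inverse where the determinant is 1. The two z's are diag(1,
   -1) and the rotation [[0, 1], [-1, 0]], orthogonal for the trace form. *)
exists (left_ext mulmx adjugate (S 1 0 0)), (left_ext mulmx adjugate (S 0 1 (-1))).
apply: (@left_invariant_complex_product R 'M[R]_n 'M[R]_1 mulmx adjugate 1%:M (SL R n) L
  _ _ _ _ _ _ _ _ _ _ _ _ _ (S 1 0 0) (S 0 1 (-1)) d b) => //.
- exact: mulmxA.
- exact: mul1mx.
- by move=> v a x y; rewrite mulmxDl -scalemxAl.
- by move=> v a x y; rewrite mulmxDr -scalemxAr.
- have oTT : open (@setT ('M[R]_n * 'M[R]_n)%type) by exact: openT.
  have cf : continuous (fst : 'M[R]_n * 'M[R]_n -> 'M[R]_n) by move=> ?; exact: cvg_fst.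
  have cs : continuous (snd : 'M[R]_n * 'M[R]_n -> 'M[R]_n) by move=> ?; exact: cvg_snd.
  apply: Ck_continuous; apply/(CkM_real _ oTT).
  have C1 : Ck 0 setT (fst : 'M[R]_n * 'M[R]_n -> 'M[R]_n) by move=> x _; exact: cf.
  have C2 : Ck 0 setT (snd : 'M[R]_n * 'M[R]_n -> 'M[R]_n) by move=> x _; exact: cs.
  have := CkM_mul oTT ((CkM_real _ oTT _).1 C1) ((CkM_real _ oTT _).1 C2).
  by apply: (CkM_ext oTT) => x _; rewrite map_mxM.
- by move=> g h; rewrite /SL /= det_mulmx => -> ->; rewrite mulr1.
- move=> g; rewrite /SL /= => dg; have := congr1 determinant (mul_mx_adj g).
  by rewrite det_mulmx dg mul1r det1.
- by move=> g; rewrite /SL /= mul_adj_mx => ->.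
- by move=> g; rewrite /SL /= mul_mx_adj => ->.
- move=> j; apply/(CkM_real _ oT).
  have C1 : Ck j setT (id : 'M[R]_n -> 'M[R]_n) by apply: Ck_lin => // x; exact: cvg_id.
  have := CkM_adj oT ((CkM_real _ oT _).1 C1).
  by apply: (CkM_ext oT) => x _; rewrite map_mx_adj.
- exact: lin_continuous_mx.
- by move=> v; rewrite (tangent_SL1 hn) LP.
- exact: kerS.
- exact: kerS.
- by move=> x Lx; rewrite sqr // gP scale1r.
- by move=> x Lx; rewrite sqr // gJ scaleN1r.
- by move=> x /LP tx; apply: (pencil_anticomm hn) => //; ring.
- by move=> x y _ _; have := nijS 1 0 0 x y; rewrite gP scale1r.
- by move=> x y _ _; have := nijS 0 1 (-1) x y; rewrite gJ scaleN1r.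
Qed.

End SpecialLinear.

(** * The structures on SU(H) *)

Section SpecialUnitary.
Context {R : realType}.
Local Notation C := R[i].
Local Open Scope sesquilinear_scope.

Lemma adjDE_form n k (Y : 'M[C]_n) : adjD k Y = dgm (sgnD k) *m Y^t* *m dgm (sgnD k).
Proof.
by apply/matrixP => a b; rewrite dgmMr dgmMl !mxE mulrAC.
Qed.

Lemma sgnD_form n k : dgm (sgnD k) *m dgm (sgnD k) = 1%:M :> 'M[C]_n.
Proof.
apply/matrixP => a b; rewrite dgmMl dgmE mxE; case: (a == b); last by rewrite mulr0.
by rewrite !mulr1n sgnD_sq.
Qed.

Lemma skew_adjD n k (Y : 'M[C]_n) :
  Y^t* *m dgm (sgnD k) + dgm (sgnD k) *m Y = 0 <-> adjD k Y = - Y.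
Proof.
rewrite adjDE_form -mulmxA; split=> [/eqP|E].
  by rewrite addr_eq0 => /eqP ->; rewrite mulmxN mulmxA sgnD_form mul1mx.
by rewrite -[Y^t* *m _]mul1mx -(sgnD_form n k) -mulmxA E mulmxN addNr.
Qed.

Lemma SU_complex_product n k (hn : n = k.*2.+1) (H Q : 'M[C]_n) :
  H^t* = H -> Q \in unitmx -> Q^t* *m H *m Q = dgm (sgnD k) ->
  exists P J, [/\ complex_product_structure (SU H) P J, left_invariant (SU H) mul_cmx P
    & left_invariant (SU H) mul_cmx J].
Proof.
move=> Hh Qu QHQ; pose V := ('M[R]_n * 'M[R]_n)%type.
pose D : 'M[C]_n := dgm (sgnD k); have DD : D *m D = 1%:M by exact: sgnD_form.
rewrite -/D in QHQ.
have Hu : H \in unitmx.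
  have dD : \det D != 0.
    have := congr1 determinant DD; rewrite det_mulmx det1; apply: contra_eq_neq => ->.
    by rewrite mulr0 eq_sym oner_eq0.
  move: dD; rewrite -QHQ !det_mulmx !mulf_eq0 !negb_or => /andP[/andP[_ dH] _].
  by rewrite unitmxE unitfE.
(* The H-orthogonal projector on the image under Q of the middle vector. This line is not isotropic,
   so scaling it by a number of modulus one preserves H while changing the determinant. *)
pose e : 'M[C]_n := Q *m mid k *m invmx Q.
have conjE s : 1%:M - e + s *: e = Q *m (1%:M - mid k + s *: mid k) *m invmx Q.
  rewrite mulmxDr mulmxDl mulmxBr mulmxBl mulmx1 mulmxV //.
  by rewrite -scalemxAr -scalemxAl.
have ee : e *m e = e.
  by rewrite /e !mulmxA mulmxKV // -(mulmxA Q (mid k)) (mul_mid_mid hn).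
have det_e s : \det (1%:M - e + s *: e) = s.
  have dQ : \det Q != 0 by rewrite -unitfE -unitmxE.
  by rewrite conjE !det_mulmx det_inv (det_reflection hn) mulrAC mulfV // mul1r.
have midC : (mid k : 'M[C]_n)^t* = mid k.
  apply/matrixP => a b; rewrite mxE (mxE _ _ a b) !dgmE [b == a]eq_sym.
  by have [->|_] := eqVneq a b; rewrite ?mulr1n ?mulr0n ?conjC0 ?rmorph_nat.
have QH : Q^t* *m H = D *m invmx Q by rewrite -QHQ mulmxK.
have HQ : H *m Q = (invmx Q)^t* *m D.
  by rewrite -QHQ -mulmxA mulmxA -ctmxM mulmxV // ctmx1 mul1mx.
have eH : e^t* *m H = H *m e.
  have eC : e^t* = (invmx Q)^t* *m mid k *m Q^t* by rewrite ctmxM ctmxM midC mulmxA.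
  have -> : H *m e = (invmx Q)^t* *m D *m (mid k *m invmx Q) by rewrite -HQ /e !mulmxA.
  rewrite eC -(mulmxA _ (Q^t*) H) QH; apply: mulmx_swap.
  by apply: (mid_comm hn); exact: dgm_D.
(* Conjugation by Q brings the form to [D], for which the levels are adapted: ker L becomes the
   traceless matrices with [adjD k Y = - Y]. *)
pose phi (v : V) : 'M[C]_n := invmx Q *m cmx v *m Q.
pose psi (Y : 'M[C]_n) : V := of_cmx (Q *m Y *m invmx Q).
have psiK Y : phi (psi Y) = Y.
  by rewrite /phi /psi of_cmxK !mulmxA mulVmx // mul1mx mulmxKV.
have phiK v : psi (phi v) = v.
  by rewrite /phi /psi !mulmxA mulmxV // mul1mx mulmxK // cmxK.
have phi_inj : injective phi := can_inj phiK.
have phiP (a : R) x y : phi (a *: x + y) = a%:C%C *: phi x + phi y.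
  by rewrite /phi cmxP mulmxDr mulmxDl -scalemxAr -scalemxAl.
have phiB x y : phi (x - y) = phi x - phi y.
  by rewrite addrC -scaleN1r phiP rmorphN rmorph1 scaleN1r addrC.
have phiD x y : phi (x + y) = phi x + phi y.
  by rewrite -[x]scale1r phiP rmorph1 !scale1r.
have phi0 : phi 0 = 0 by rewrite -(subrr (0 : V)) phiB subrr.
have phiM x y : phi (mul_cmx x y) = phi x *m phi y.
  by rewrite /phi cmx_mul !mulmxA mulmxK.
pose W := (('M[R]_n * 'M[R]_n) * ('M[R]_1 * 'M[R]_1))%type.
pose L (v : V) : W := (of_cmx ((cmx v)^t* *m H + H *m cmx v), of_cmx (\tr (cmx v))%:M).
have LE v : L v = 0 <-> (cmx v)^t* *m H + H *m cmx v = 0 /\ \tr (cmx v) = 0.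
  have cmx0 m : cmx (0 : 'M[R]_m * 'M[R]_m) = 0 by apply/matrixP => a b; rewrite !mxE.
  rewrite /L; split=> [/(congr1 (fun q : W => (cmx q.1, cmx q.2)))|[-> ->]].
    rewrite /= !of_cmxK !cmx0 => -[-> E2]; split=> //.
    by have /matrixP /(_ ord0 ord0) := E2; rewrite !mxE eqxx mulr1n.
  by congr (_, _); apply: cmx_inj; rewrite of_cmxK cmx0 ?raddf0.
have LP v : L v = 0 <-> adjD k (phi v) = - phi v /\ \tr (phi v) = 0.
  have trphi : \tr (phi v) = \tr (cmx v).
    by rewrite /phi -mulmxA mxtrace_mulC mulmxK.
  have phiform : (phi v)^t* *m D + D *m phi v = Q^t* *m ((cmx v)^t* *m H + H *m cmx v) *m Q.
    have QX : Q *m phi v = cmx v *m Q by rewrite /phi !mulmxA mulmxV // mul1mx.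
    have QX' : (phi v)^t* *m Q^t* = Q^t* *m (cmx v)^t* by rewrite -!ctmxM QX.
    by rewrite -QHQ -(mulmxA _ Q (phi v)) QX !mulmxA QX' mulmxDr mulmxDl !mulmxA.
  rewrite LE trphi -skew_adjD phiform; split=> -[E1 E2]; split=> //.
    by rewrite E1 mulmx0 mul0mx.
  have Qtu : Q^t* \in unitmx by rewrite unitmxE det_ctmx unitfE conjC_eq0 -unitfE -unitmxE.
  by apply: (can_inj (mulKmx Qtu)); apply: (can_inj (mulmxK Qu)); rewrite E1 mulmx0 mul0mx.
have linL : linear L.
  move=> a x y; rewrite /L cmxP ctmxD ctmxZ conj_real; congr (_, _) => /=; rewrite -of_cmxP.
    congr of_cmx; rewrite mulmxDl mulmxDr -scalemxAl -scalemxAr scalerDr addrACA //.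
  by congr of_cmx; rewrite linearP /= raddfD /= scale_scalar_mx.
clearbody phi psi L.
have lincont (U : normedModType R) (f : V -> U) : linear f -> continuous f.
  by apply: lin_continuous_pair => g; exact: lin_continuous_mx.
have [d [b basis]] := @ker_basis R V W L linL.
pose S al be (v : V) : V := psi (pencil k al be (be^*) 'i (phi v)).
have phiS al be v : phi (S al be v) = pencil k al be (be^*) 'i (phi v) by exact: psiK.
clearbody S.
have linS al be : linear (S al be).
  move=> a x y; apply: phi_inj; rewrite phiS !phiP !phiS.
  by rewrite [a%:C%C *: phi x + _]addrC pencilP [RHS]addrC.
have two0 : (2 : C) != 0 by rewrite pnatr_eq0.
have w0 : ('i : C) != 0 by exact: neq0Ci.
have wc : ('i : C)^* = 'i^-1 by rewrite conjCi invCi.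
have wim : ('i : C) + 'i^-1 = 0 by rewrite invCi subrr.
have kerS al be x : al^* = - al -> L x = 0 -> L (S al be x) = 0.
  move=> alc /LP[adx tx]; apply/LP; rewrite phiS (tr_pencil hn) //; split=> //.
  by rewrite (adjD_pencil hn) // adx pencilN.
have sqr al be x : L x = 0 -> phi (S al be (S al be x)) = gen_sq al be (be^*) *: phi x.
  by move=> /LP[_ tx]; exact: (transfer_sqr hn two0 w0 (phiS al be)).
have nijS al be x y := transfer_nij hn two0 phiB phiM (phiS al be) x y.
have c0 : (0 : C)^* = 0 by exact: conjC0.
have c1 : (1 : C)^* = 1 by exact: conjC1.
have gP : gen_sq (0 : C) 1 (1^*) = 1 by rewrite /gen_sq c1 expr0n mul1r add0r.
have gJ : gen_sq ('i : C) 0 (0^*) = -1 by rewrite /gen_sq mul0r addr0 sqrCi.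
have oT : open (@setT V) by exact: openT.
(* The two z's are [[0, 1], [1, 0]] and diag(i, -i): elements of su(1,1) with squares 1 and -1,
   orthogonal for the trace form. *)
exists (left_ext mul_cmx (inv_SU H) (S 0 1)), (left_ext mul_cmx (inv_SU H) (S 'i 0)).
apply: (@left_invariant_complex_product R V W mul_cmx (inv_SU H) (of_cmx 1%:M) (SU H) L
  _ _ _ _ _ _ _ _ _ _ _ _ _ (S 0 1) (S 'i 0) d b) => //.
- by move=> x y z; apply: cmx_inj; rewrite !cmx_mul mulmxA.
- by move=> x; apply: cmx_inj; rewrite cmx_mul of_cmxK mul1mx.
- by move=> v a x y; apply: cmx_inj; rewrite cmx_mul !cmxP !cmx_mul mulmxDl -scalemxAl.
- by move=> v a x y; apply: cmx_inj; rewrite cmx_mul !cmxP !cmx_mul mulmxDr -scalemxAr.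
- have oTT : open (@setT (V * V)%type) by exact: openT.
  apply: Ck_continuous; apply: (CkM_of_cmx oTT); apply: (CkM_mul oTT).
    by apply: (CkM_cmx oTT) => x _; exact: cvg_fst.
  by apply: (CkM_cmx oTT) => x _; exact: cvg_snd.
- by move=> g h; exact: SU_mul.
- by move=> g; exact: SU_inv.
- by move=> g; exact: SU_mulVx.
- by move=> g; exact: SU_mulxV.
- by move=> j; apply: Ck_lin; [exact: inv_SU_linear|exact/lincont/inv_SU_linear].
- exact: lincont.
- by move=> v; rewrite LE; exact: (SU_tangent1 Hu ee eH det_e).
- exact/lincont/linS.
- exact/lincont/linS.
- by move=> x; apply: kerS; rewrite oppr0.
- by move=> x; apply: kerS; exact: conjCi.
- by move=> x Lx; apply: phi_inj; rewrite sqr // gP scale1r.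
- by move=> x Lx; apply: phi_inj; rewrite sqr // gJ scaleN1r -(sub0r (phi x)) -phi0 -phiB sub0r.
- move=> x /LP[_ tx]; apply: phi_inj.
  rewrite -[- S 'i 0 _]sub0r phiB phi0 sub0r !phiS.
  by apply: (pencil_anticomm hn) => //; rewrite c0 c1; ring.
- move=> x y _ _; apply: phi_inj; have := nijS 0 1 x y; rewrite gP phi0 scale1r => <-.
  by rewrite phiB phiB phiD.
- move=> x y _ _; apply: phi_inj; have := nijS 'i 0 x y; rewrite gJ phi0 scaleN1r => <-.
  by rewrite phiB phiB phiB.
Qed.

End SpecialUnitary.

Theorem theorem1p1 (R : realType) (m : nat) (hm : (1 < m)%N) :
  (exists P J,
     [/\ complex_product_structure (SL R (2 * m - 1)) P J,
         left_invariant (SL R (2 * m - 1)) mulmx P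
       & left_invariant (SL R (2 * m - 1)) mulmx J])
  /\
  (forall H : 'M[R[i]]_(m + (m - 1)),
     hermitian_signature m (m - 1) H ->
   exists P J,
     [/\ complex_product_structure (SU H) P J,
         left_invariant (SU H) mul_cmx P
       & left_invariant (SU H) mul_cmx J]).
Proof.
split; first by apply: (@SL_complex_product _ _ (m - 1)%N); lia.
move=> H [/is_hermitianmxP Hh [Q Qu QHQ]].
apply: (@SU_complex_product _ _ (m - 1)%N _ H Q) => //; first lia.
  by rewrite [RHS]Hh expr0 scale1r.
(* With k = m - 1, the standard form of signature (m, m - 1) has its k + 1 plus signs first, exactly
   the indices a <= k of [sgnD]. *)
rewrite QHQ; apply/matrixP => a b; rewrite dgmE /sgnD.
case: (split_ordP a) => a' ->; case: (split_ordP b) => b' ->.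
- rewrite block_mxEul mxE /= (inj_eq (@lshift_inj _ _)) ifT //.
  by have := ltn_ord a'; lia.
- rewrite block_mxEur mxE eq_lrshift mulr0n //.
- rewrite block_mxEdl mxE eq_rlshift mulr0n //.
- rewrite block_mxEdr !mxE /= (inj_eq (@rshift_inj _ _)) ifF ?mulNrn //.
  by apply/negbTE; rewrite -ltnNge; have := ltn_ord b'; lia.
Qed.
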